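(* Let $\mathcal{E}$ be the infinite prolongation of $u_t=u_5+(4\alpha-6\beta)u_1u_2+(8\alpha-2\beta)u_0u_3-20\alpha\beta u_0^2u_1$, with $\alpha,\beta\in\mathbb{K}$, and let $a\in\mathcal{E}$. (1) If $\alpha+\beta\neq0$, $6\alpha+\beta\neq0$, $16\alpha+\beta\neq0$ and $\alpha\neq0$, then $\mathbb{F}^0(\mathcal{E},a)$ is isomorphic to the direct sum of $\mathfrak{sl}_2(\mathbb{K})$ and an abelian Lie algebra of dimension $\le3$. (2) If $\alpha=0$ and $\beta\neq0$, then $\mathbb{F}^0(\mathcal{E},a)$ is nilpotent and of dimension $\le6$.
   Context: $\mathbb{K}$ is $\mathbb{C}$ or $\mathbb{R}$; $u_k=\partial^ku/\partial x^k$. For the evolution equation $u_t=F(u_0,\dots,u_5)$ its infinite prolongation $\mathcal{E}$ is $\mathbb{K}^\infty$ with coordinates $x,t,u_0,u_1,\dots$, with $D_x=\partial_x+\sum_{k\ge0}u_{k+1}\partial_{u_k}$, $D_t=\partial_t+\sum_{k\ge0}D_x^k(F)\partial_{u_k}$. For $a\in\mathcal{E}$ with coordinates $x_a,t_a,a_k$, the Lie algebra $\mathbb{F}^0(\mathcal{E},a)$ has generators $\mathcal{A}^{l_1,l_2}_{i_0}$, $\mathcal{B}^{l_1,l_2}_{j_0j_1j_2j_3j_4}$ (all nonnegative indices) and relations: (i) all coefficients of $D_x(\mathcal{B})-D_t(\mathcal{A})+[\mathcal{A},\mathcal{B}]$ vanish, where $\mathcal{A}=\sum(x-x_a)^{l_1}(t-t_a)^{l_2}(u_0-a_0)^{i_0}\mathcal{A}^{l_1,l_2}_{i_0}$,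 $\mathcal{B}=\sum(x-x_a)^{l_1}(t-t_a)^{l_2}\prod_{r=0}^{4}(u_r-a_r)^{j_r}\mathcal{B}^{l_1,l_2}_{j_0\dots j_4}$, the functions $u_{k+1}$, $D_x^k(F)$ are expanded in Taylor series at $a$, and brackets are computed coefficientwise; (ii) $\mathcal{A}^{l_1,l_2}_{0}=0$ and $\mathcal{B}^{0,l_2}_{00000}=0$ for all $l_1,l_2$. *)

(* Defs.v *)
From HB Require Import structures.
From mathcomp Require Import all_boot all_order all_algebra.
From mathcomp Require Import reals.
From mathcomp Require Import complex.
Set Implicit Arguments. Unset Strict Implicit. Unset Printing Implicit Defensive.
Import Order.TTheory GRing.Theory Num.Theory.
Local Open Scope ring_scope.

Section Lie.
Variable K : fieldType.

Definition lie_axioms (L : lmodType K) (br : L -> L -> L) : Prop :=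
  [/\ (forall (c : K) x y z, br (c *: x + y) z = c *: br x z + br y z),
      (forall (c : K) x y z, br x (c *: y + z) = c *: br x y + br x z),
      (forall x, br x x = 0) &
      (forall x y z, br x (br y z) + br y (br z x) + br z (br x y) = 0)].

Definition lie_hom (L M : lmodType K) (brL : L -> L -> L) (brM : M -> M -> M)
  (phi : L -> M) : Prop :=
  (forall (c : K) x y, phi (c *: x + y) = c *: phi x + phi y) /\
  (forall x y, phi (brL x y) = brM (phi x) (phi y)).

Definition lie_generated (L : lmodType K) (br : L -> L -> L) (G : L -> Prop) : Prop :=
  forall S : L -> Prop,
    (forall x, G x -> S x) -> S 0 ->
    (forall x y, S x -> S y -> S (x + y)) ->
    (forall (c : K) x, S x -> S (c *: x)) ->
    (forall x y, S x -> S y -> S (br x y)) ->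
    forall x, S x.

Inductive lcs (L : lmodType K) (br : L -> L -> L) : nat -> L -> Prop :=
  | lcs_base : forall x, lcs br 0 x
  | lcs_zero : forall k, lcs br k.+1 0
  | lcs_add  : forall k x y, lcs br k.+1 x -> lcs br k.+1 y -> lcs br k.+1 (x + y)
  | lcs_scale : forall k (c : K) x, lcs br k.+1 x -> lcs br k.+1 (c *: x)
  | lcs_br : forall k x y, lcs br k y -> lcs br k.+1 (br x y).

Definition lie_nilpotent (L : lmodType K) (br : L -> L -> L) : Prop :=
  exists k, forall x, lcs br k x -> x = 0.

Definition dim_le (L : lmodType K) (d : nat) : Prop :=
  exists s : seq L, (size s <= d)%N /\
    forall x, exists c : nat -> K, x = \sum_(i < size s) c i *: s`_i.

Definition iso_sl2_plus_abelian (L : lmodType K) (br : L -> L -> L) (d : nat) : Prop :=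
  exists n : nat, (n <= d)%N /\
  exists (p1 : L -> 'M[K]_2) (p2 : L -> 'rV[K]_n),
    [/\ (forall (c : K) x y, p1 (c *: x + y) = c *: p1 x + p1 y /\
                             p2 (c *: x + y) = c *: p2 x + p2 y),
        (forall x y, p1 x = p1 y -> p2 x = p2 y -> x = y),
        (forall x, \tr (p1 x) = 0),
        (forall (X : 'M[K]_2) (w : 'rV[K]_n), \tr X = 0 ->
            exists x, p1 x = X /\ p2 x = w) &
        (forall x y, p1 (br x y) = p1 x *m p1 y - p1 y *m p1 x /\ p2 (br x y) = 0)].

(* ---------- formal power series in the 8 variables
   y_0 = x - x_a, y_1 = t - t_a, y_{r+2} = u_r - a_r (r = 0..5),
   with coefficients in L : a series is its coefficient function mono -> L. ---------- *)
Definition mono := 'I_8 -> nat.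
Definition vr (k : nat) : 'I_8 := inord k.
Definition eunit (i : 'I_8) : mono := fun j => if j == i then 1%N else 0%N.
Definition madd (m n : mono) : mono := fun j => (m j + n j)%N.
Definition msub (m n : mono) : mono := fun j => (m j - n j)%N.
Definition msum (m : mono) : nat := (\sum_(i < 8) m i)%N.

Variable L : lmodType K.

Definition subsum (m : mono) (f : mono -> L) : L :=
  \sum_(n : {ffun 'I_8 -> 'I_(msum m).+1} | [forall i, (n i <= m i)%N])
     f (fun i => nat_of_ord (n i)).

Definition sderiv (i : 'I_8) (S : mono -> L) : mono -> L :=
  fun m => (m i).+1%:R *: S (madd m (eunit i)).
Definition smulvar (i : 'I_8) (S : mono -> L) : mono -> L :=
  fun m => if (0 < m i)%N then S (msub m (eunit i)) else 0.
Definition smulpoly (P : mono -> K) (S : mono -> L) : mono -> L :=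
  fun m => subsum m (fun n => P n *: S (msub m n)).
Definition sbr (br : L -> L -> L) (A B : mono -> L) : mono -> L :=
  fun m => subsum m (fun n => br (A n) (B (msub m n))).

End Lie.

Definition upoly (K : fieldType) := seq (K * (nat -> nat)).
Definition ex (l : seq nat) : nat -> nat := fun r => nth 0%N l r.

(* coefficient of y^n in the Taylor expansion at a of P (sum of c * prod_r u_r^(e r));
   uses u_r = a_r + y_{r+2}, so the coefficient of prod_r y_{r+2}^{n_r} is
   sum c * prod_r binom(e r, n_r) a_r^(e r - n_r). *)
Definition taylor (K : fieldType) (P : upoly K) (ak : nat -> K) : mono -> K :=
  fun n => if (n (vr 0) == 0%N) && (n (vr 1) == 0%N) then
     \sum_(ce <- P) ce.1 * \prod_(r < 6)
         ('C(ce.2 r, n (vr (r + 2)))%:R * ak r ^+ (ce.2 r - n (vr (r + 2))))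
   else 0.

Definition Fpoly (K : fieldType) (al be : K) : upoly K :=
  [:: (1, ex [:: 0; 0; 0; 0; 0; 1]%N);
      (4%:R * al - 6%:R * be, ex [:: 0; 1; 1]%N);
      (8%:R * al - 2%:R * be, ex [:: 1; 0; 0; 1]%N);
      (- (20%:R * al * be), ex [:: 2; 1]%N)].

Section Presentation.
Variables (K : fieldType) (al be : K) (xa ta : K) (ak : nat -> K).
Variables (L : lmodType K) (br : L -> L -> L).
Variables (gA : nat -> nat -> nat -> L)
          (gB : nat -> nat -> nat -> nat -> nat -> nat -> nat -> L).

Definition Aser : mono -> L := fun m =>
  if [forall j : 'I_8, (2 < j)%N ==> (m j == 0%N)] then gA (m (vr 0)) (m (vr 1)) (m (vr 2))
  else 0.
Definition Bser : mono -> L := fun m =>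
  if m (vr 7) == 0%N then
    gB (m (vr 0)) (m (vr 1)) (m (vr 2)) (m (vr 3)) (m (vr 4)) (m (vr 5)) (m (vr 6))
  else 0.

(* coefficient of y^m in D_x(B) - D_t(A) + [A, B];
   D_x = d_x + sum_k u_{k+1} d_{u_k} (only k <= 4 act on B),
   D_t = d_t + sum_k D_x^k(F) d_{u_k} (only k = 0 acts on A),
   with u_{k+1} = a_{k+1} + y_{k+3} and F Taylor-expanded at a. *)
Definition zc_coef (m : mono) : L :=
  sderiv (vr 0) Bser m
  + \sum_(k < 5) (ak k.+1 *: sderiv (vr (k + 2)) Bser m
                  + smulvar (vr (k + 3)) (sderiv (vr (k + 2)) Bser) m)
  - (sderiv (vr 1) Aser m + smulpoly (taylor (Fpoly al be) ak) (sderiv (vr 2) Aser) m)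
  + sbr br Aser Bser m.

Definition F0_relations : Prop :=
  [/\ (forall m, zc_coef m = 0),
      (forall l1 l2, gA l1 l2 0%N = 0) &
      (forall l2, gB 0%N l2 0%N 0%N 0%N 0%N 0%N = 0)].

Definition is_generator (x : L) : Prop :=
  (exists l1 l2 i0, x = gA l1 l2 i0) \/
  (exists l1 l2 j0 j1 j2 j3 j4, x = gB l1 l2 j0 j1 j2 j3 j4).

End Presentation.

(* (L, br, gA, gB) is a presentation of F^0(E, a): the Lie algebra with
   generators A, B and relations (i), (ii) (universal property + generation). *)
Definition is_F0 (K : fieldType) (al be xa ta : K) (ak : nat -> K)
  (L : lmodType K) (br : L -> L -> L)
  (gA : nat -> nat -> nat -> L)
  (gB : nat -> nat -> nat -> nat -> nat -> nat -> nat -> L) : Prop :=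
  [/\ lie_axioms br,
      F0_relations al be ak br gA gB,
      lie_generated br (is_generator gA gB) &
      forall (M : lmodType K) (brM : M -> M -> M)
             (hA : nat -> nat -> nat -> M)
             (hB : nat -> nat -> nat -> nat -> nat -> nat -> nat -> M),
        lie_axioms brM -> F0_relations al be ak brM hA hB ->
        exists phi : L -> M, lie_hom br brM phi /\
          (forall l1 l2 i0, phi (gA l1 l2 i0) = hA l1 l2 i0) /\
          (forall l1 l2 j0 j1 j2 j3 j4,
             phi (gB l1 l2 j0 j1 j2 j3 j4) = hB l1 l2 j0 j1 j2 j3 j4)].

Definition theorem4p9_over (K : fieldType) : Prop :=
  forall (al be xa ta : K) (ak : nat -> K) (L : lmodType K) (br : L -> L -> L)
         (gA : nat -> nat -> nat -> L)
         (gB : nat -> nat -> nat -> nat -> nat -> nat -> nat -> L),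
    is_F0 al be xa ta ak br gA gB ->
    (al + be != 0 -> 6%:R * al + be != 0 -> 16%:R * al + be != 0 -> al != 0 ->
       iso_sl2_plus_abelian br 3) /\
    (al = 0 -> be != 0 -> lie_nilpotent br /\ dim_le L 6).

(* Main.v *)
(* Write A' for dA/du_0. Comparing derivatives of the zero-curvature equation with respect to
   u_5, ..., u_0 expresses dB/du_k through covariant derivatives of A'; equality of mixed
   derivatives of B then forces A'' = 0 when 6 al + be <> 0, so that A = (u_0 - a_0) P with
   P = P(x, t). With P_k the k-th x-derivative of P, the remaining equations are
   [P_0, [P_0, P_1]] = 0, [P_0, P_2] = -4 al P_1, a relation for [P_1, P_3] + 3 [P_0, P_4], and
   an evolution equation for P. Q = [P_0, P_1] + 4 al P_0 is annihilated by d/dx and commutes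
   with all P_k. The evolution acts on brackets as a derivation, so the defect of the Leibniz
   rule for d^5/dx^5 commutes with P_0; this gives
   (al + be) (6 al + be) (16 al + be) (P_3 + 8 al a_0 P_1) = 0, whence P_3 = -8 al a_0 P_1.
   The gauge conditions turn all this into a linear system with constant coefficients, so the
   algebra is spanned by the values of P_0, P_1, P_2, Q at a, and Q is central. If al = 0 it is
   nilpotent of class 2. If al <> 0 the brackets are those of gl_2, and an explicit gl_2-valued
   solution shows that there is no further collapse. *)

(* In characteristic zero a series is determined by its constant term and its partial derivatives,
   so bracket identities, exponential flows and the span argument are all proved by induction over
   monomials, one differentiation per step. The three excluded factors have separate origins. With V
   = P_3 + 8 al a_0 P_1, two linear equations give [P_1, V] = la V with la proportional to 6 al +
   be, and [P_0, dV/dx] = - p V with p proportional to al + be. The factor 16 al + be is that of a -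
   la, where a = 4 al; it arises when ad P_0 is moved past ad P_1, because ad [P_0, P_1] acts as - a
   ad P_0 on everything that commutes with Q. The span argument bounds the dimension by four but
   cannot exclude a smaller algebra. For al <> 0 this is settled by the universal property, which
   turns a matrix-valued solution into a homomorphism onto gl_2; the abelian summand is then the
   line of scalar matrices. *)
Require Import Defs.
From mathcomp Require Import all_boot all_order all_algebra.
From mathcomp Require Import reals complex.
From mathcomp Require Import boolp functions.
From mathcomp Require Import ring lra zify.
Set Implicit Arguments. Unset Strict Implicit. Unset Printing Implicit Defensive.
Import Order.TTheory GRing.Theory Num.Theory.
Local Open Scope ring_scope.

(** * Linear identities in modules *)

(* Both sides of an equation are expanded over monomials in the commuting operators X i
   applied to atoms, and the coefficients are compared by ring or field. *)
Section ModuleNormalForm.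
Variables (K : comNzRingType) (S : lmodType K).

Inductive mexp : Type :=
  | MZero
  | MAtom of nat
  | MAdd of mexp & mexp
  | MOpp of mexp
  | MScale of K & mexp
  | MShift of nat & mexp.

Variables (X : nat -> S -> S) (env : seq S).

Fixpoint meval (e : mexp) : S :=
  match e with
  | MZero => 0
  | MAtom n => nth 0 env n
  | MAdd e1 e2 => meval e1 + meval e2
  | MOpp e1 => - meval e1
  | MScale k e1 => k *: meval e1
  | MShift i e1 => X i (meval e1)
  end.

Fixpoint minsert (i : nat) (s : seq nat) : seq nat :=
  match s with
  | [::] => [:: i]
  | j :: s' => if Nat.leb i j then i :: s else j :: minsert i s'
  end.

(** [m] is the sorted word of operators above the current subterm and [k] its accumulated
    coefficient. Sorting makes words canonical, which is sound for commuting operators. *)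
Fixpoint mnorm (e : mexp) (m : seq nat) (k : K) : seq (K * (seq nat * nat)) :=
  match e with
  | MZero => [::]
  | MAtom n => [:: (k, (m, n))]
  | MAdd e1 e2 => mnorm e1 m k ++ mnorm e2 m k
  | MOpp e1 => mnorm e1 m (- k)
  | MScale k1 e1 => mnorm e1 m (k * k1)
  | MShift i e1 => mnorm e1 (minsert i m) k
  end.

Fixpoint natseq_eqb (s t : seq nat) : bool :=
  match s, t with
  | [::], [::] => true
  | i :: s', j :: t' => if Nat.eqb i j then natseq_eqb s' t' else false
  | _, _ => false
  end.

Definition key_eqb (x y : seq nat * nat) : bool :=
  if Nat.eqb x.2 y.2 then natseq_eqb x.1 y.1 else false.

Fixpoint key_sum (x : seq nat * nat) (k : K) (s : seq (K * (seq nat * nat)))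
    : K * seq (K * (seq nat * nat)) :=
  match s with
  | [::] => (k, [::])
  | t :: s' => if key_eqb x t.2 then key_sum x (k + t.1) s'
               else let: (k', r) := key_sum x k s' in (k', t :: r)
  end.

(** One scalar equation per distinct key, as a conjunction left to [ring] or [field]. The recursion
    is on the list returned by [key_sum], not on a subterm, hence the fuel. *)
Fixpoint mvanish (fuel : nat) (s : seq (K * (seq nat * nat))) : Prop :=
  match fuel, s with
  | _, [::] => True
  | 0%N, _ => False
  | f.+1, t :: s' => let: (k, r) := key_sum t.2 t.1 s' in k = 0 /\ mvanish f r
  end.

Hypothesis XL : forall i (k : K) x y, X i (k *: x + y) = k *: X i x + X i y.
Hypothesis XC : forall i j x, X i (X j x) = X j (X i x).

Let XD i x y : X i (x + y) = X i x + X i y.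
Proof. by rewrite -{1}[x]scale1r XL scale1r. Qed.
Let X0 i : X i 0 = 0.
Proof. by have := XD i 0 0; rewrite addr0 => /eqP; rewrite -subr_eq0 opprD addNKr oppr_eq0 =>
  /eqP. Qed.
Let XZ i k x : X i (k *: x) = k *: X i x.
Proof. by have := XL i k x 0; rewrite !addr0 X0 addr0. Qed.

Definition kval (x : seq nat * nat) : S := foldr X (nth 0 env x.2) x.1.
Definition nval (s : seq (K * (seq nat * nat))) : S :=
  \sum_(t <- s) t.1 *: kval t.2.

Let foldr_minsert i s v : foldr X v (minsert i s) = X i (foldr X v s).
Proof. by elim: s => //= j s IH; case: ifP => //= _; rewrite IH XC. Qed.

Let foldrL m k x y : foldr X (k *: x + y) m = k *: foldr X x m + foldr X y m.
Proof. by elim: m => //= i m ->; rewrite XL. Qed.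
Let foldrX m i x : foldr X (X i x) m = X i (foldr X x m).
Proof. by elim: m => //= j m ->; rewrite XC. Qed.
Let foldr0 m : foldr X 0 m = 0.
Proof. by elim: m => //= j m ->; rewrite X0. Qed.
Let foldrD m x y : foldr X (x + y) m = foldr X x m + foldr X y m.
Proof. by rewrite -{1}[x]scale1r foldrL scale1r. Qed.
Let foldrZ m k x : foldr X (k *: x) m = k *: foldr X x m.
Proof. by rewrite -{1}[k *: x]addr0 foldrL foldr0 addr0. Qed.

Lemma mnormP e m k : nval (mnorm e m k) = k *: foldr X (meval e) m.
Proof.
elim: e m k => /=.
- by move=> m k; rewrite /nval big_nil foldr0 scaler0.
- by move=> n m k; rewrite /nval big_seq1.
- by move=> e1 I1 e2 I2 m k; rewrite /nval big_cat /= -/(nval _) -/(nval _) I1 I2 foldrD scalerDr.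
- by move=> e1 I1 m k; rewrite I1 -[in RHS]scaleN1r foldrZ scalerA mulrN1.
- by move=> k1 e1 I1 m k; rewrite I1 foldrZ scalerA.
- by move=> i e1 I1 m k; rewrite I1 foldr_minsert foldrX.
Qed.

Let natseq_eqbP s t : natseq_eqb s t -> s = t.
Proof.
elim: s t => [|i s IH] [|j t] //=.
by case E: (Nat.eqb i j) => // /IH ->; rewrite (proj1 (PeanoNat.Nat.eqb_eq i j) E).
Qed.

Let key_eqbP x y : key_eqb x y -> x = y.
Proof.
case: x y => [s i] [t j]; rewrite /key_eqb /=; case E: (Nat.eqb i j) => // /natseq_eqbP ->.
by rewrite (proj1 (PeanoNat.Nat.eqb_eq i j) E).
Qed.

Lemma key_sumP x k s : nval ((k, x) :: s) =
  (key_sum x k s).1 *: kval x + nval (key_sum x k s).2.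
Proof.
rewrite /nval; elim: s k => [|t s IH] k /=; first by rewrite big_seq1 big_nil addr0.
case: ifP => [/key_eqbP e|_].
  by rewrite -IH !big_cons /= -e scalerDl addrA.
have := IH k; case: (key_sum x k s) => k' r /=; rewrite !big_cons /= => e.
by rewrite addrCA e addrCA.
Qed.

Lemma mvanishP fuel s : mvanish fuel s -> nval s = 0.
Proof.
elim: fuel s => [|f IH] [|[k x] s] //=; rewrite ?/nval ?big_nil //.
by have := key_sumP x k s; rewrite /nval => ->; case: (key_sum x k s) => k' r /= [-> /IH];
  rewrite /nval => ->; rewrite scale0r addr0.
Qed.

Lemma mexp_eq e1 e2 :
  mvanish 1000 (mnorm (MAdd e1 (MOpp e2)) [::] 1) -> meval e1 = meval e2.
Proof.
move=> /mvanishP; rewrite mnormP /= scale1r => /eqP.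
by rewrite subr_eq0 => /eqP.
Qed.

End ModuleNormalForm.

Ltac m_in x l :=
  match l with
  | cons ?y _ => let u := match goal with _ => unify x y end in constr:(true)
  | cons _ ?l' => m_in x l'
  | _ => constr:(false)
  end.
Ltac m_idx x l :=
  match l with
  | cons ?y _ => let u := match goal with _ => unify x y end in constr:(0%N)
  | cons _ ?l' => let n := m_idx x l' in constr:(S n)
  end.
Ltac m_atoms X t l :=
  lazymatch t with
  | @GRing.add _ ?a ?b => let l1 := m_atoms X a l in m_atoms X b l1
  | @GRing.opp _ ?a => m_atoms X a l
  | @GRing.scale _ _ _ ?a => m_atoms X a l
  | @GRing.natmul _ ?a _ => m_atoms X a l
  | @GRing.zero _ => l
  | X _ ?a => m_atoms X a l
  (* The inner match fails unless [t] is already listed; the second branch then adds it. *)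
  | _ => match l with
         | _ => match m_in t l with true => l end
         | _ => constr:(cons t l)
         end
  end.
Ltac m_reify K X t l :=
  lazymatch t with
  | @GRing.add _ ?a ?b =>
      let a' := m_reify K X a l in let b' := m_reify K X b l in constr:(@MAdd K a' b')
  | @GRing.opp _ ?a => let a' := m_reify K X a l in constr:(@MOpp K a')
  | @GRing.scale _ _ ?k ?a => let a' := m_reify K X a l in constr:(@MScale K k a')
  | @GRing.zero _ => constr:(@MZero K)
  | X ?i ?a => let a' := m_reify K X a l in constr:(@MShift K i a')
  | _ => let n := m_idx t l in constr:(@MAtom K n)
  end.
Ltac m_done fld := repeat match goal with |- _ /\ _ => split; [fld | ] end;
  first [exact I | fail 1 "unequal normal forms"].
Ltac modnf K S X XL XC fld :=
  lazymatch goal with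
  | |- ?lhs = ?rhs =>
    let l0 := constr:(@nil S) in
    let l1 := m_atoms X lhs l0 in
    let l := m_atoms X rhs l1 in
    let e1 := m_reify K X lhs l in
    let e2 := m_reify K X rhs l in
    refine (@mexp_eq K S X l XL XC e1 e2 _);
    cbv [mnorm mvanish key_sum key_eqb natseq_eqb minsert Nat.eqb Nat.leb cat fst snd];
    m_done fld
  end.


(** * Certificates: linear combinations of known equations *)

Section LinearCombination.
Variables (K : comNzRingType) (S : lmodType K).

Lemma eq_scaled (k : K) (l r : S) : l = r -> k *: (l - r) = 0.
Proof. by move=> ->; rewrite subrr scaler0. Qed.
Lemma eq0_add (v w : S) : v = 0 -> w = 0 -> v + w = 0.
Proof. by move=> -> ->; rewrite addr0. Qed.
Lemma eq_from_comb (w l r : S) : w = 0 -> l - r = w -> l = r.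
Proof. by move=> -> /eqP; rewrite subr_eq0 => /eqP. Qed.

(** A dummy family of operators, for identities that involve the module structure alone. *)
Definition noshift (i : nat) (x : S) : S := x.
Lemma noshiftL i (k : K) x y : noshift i (k *: x + y) = k *: noshift i x + noshift i y.
Proof. by []. Qed.
Lemma noshiftC i j x : noshift i (noshift j x) = noshift j (noshift i x).
Proof. by []. Qed.
End LinearCombination.
Arguments noshift {K S}.

(** Syntax for a certificate; [modlin] and [modlin0] check that the difference of the two sides of
    the goal equals the certified combination. *)
Notation "k '**' H" := (eq_scaled k H) (at level 40).
Notation "H '+++' H'" := (eq0_add H H') (at level 50, left associativity).

Ltac coef_field := try reflexivity; first [ring | (field; try done)].
Ltac modlin K S X XL XC H := apply: (eq_from_comb H); modnf K S X XL XC coef_field.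
Ltac mod0 K S := modnf K S (@noshift K S) (@noshiftL K S) (@noshiftC K S) coef_field.
Ltac modlin0 K S H := apply: (eq_from_comb H); mod0 K S.

(** * Formal power series *)

Section LinearMap.
Variables (K : numFieldType) (U V : lmodType K) (f : U -> V).
Hypothesis fL : forall (c : K) x y, f (c *: x + y) = c *: f x + f y.

Lemma linD x y : f (x + y) = f x + f y.
Proof. by rewrite -{1}[x]scale1r fL scale1r. Qed.
Lemma lin0 : f 0 = 0.
Proof. by apply: (addIr (f 0)); rewrite -linD !add0r. Qed.
Lemma linZ c x : f (c *: x) = c *: f x.
Proof. by rewrite -{1}[c *: x]addr0 fL lin0 addr0. Qed.
Lemma linN x : f (- x) = - f x.
Proof. by rewrite -scaleN1r linZ scaleN1r. Qed.
Lemma linB x y : f (x - y) = f x - f y.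
Proof. by rewrite linD linN. Qed.
Lemma lin_sum (I : Type) (r : seq I) (Q : pred I) (F : I -> U) :
  f (\sum_(i <- r | Q i) F i) = \sum_(i <- r | Q i) f (F i).
Proof.
elim: r => [|i r IH]; rewrite ?big_nil ?lin0 // !big_cons; case: ifP => // _.
by rewrite linD IH.
Qed.
End LinearMap.

(** * Convolution products and the Leibniz rule *)

Section Convolution.
Variables (K : numFieldType) (U V W : lmodType K) (b : U -> V -> W).
Hypothesis bL : forall (c : K) x y z, b (c *: x + y) z = c *: b x z + b y z.
Hypothesis bR : forall (c : K) x y z, b x (c *: y + z) = c *: b x y + b x z.

Let bZl c x z : b (c *: x) z = c *: b x z := linZ (fun c x y => bL c x y z) c x.
Let bZr c x z : b x (c *: z) = c *: b x z := linZ (fun c y z => bR c x y z) c z.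

Definition conv (f : mono -> U) (g : mono -> V) : mono -> W :=
  fun m => subsum m (fun n => b (f n) (g (msub m n))).

Lemma convL c f f' g : conv (c *: f + f') g = c *: conv f g + conv f' g.
Proof.
apply/funext => m; rewrite !fctE /conv /subsum /= scaler_sumr -big_split /=.
by apply: eq_bigr => n _; rewrite bL.
Qed.

Lemma convR c f g g' : conv f (c *: g + g') = c *: conv f g + conv f g'.
Proof.
apply/funext => m; rewrite !fctE /conv /subsum /= scaler_sumr -big_split /=.
by apply: eq_bigr => n _; rewrite bR.
Qed.

(** The range of [subsum] as functions into [nat]: without the bound [(msum m).+1] in the type, the
    ranges for different [m] can be compared. *)
Definition below (m : mono) : seq {ffun 'I_8 -> nat} :=
  [seq [ffun i => nat_of_ord (n i)] |
    n : {ffun 'I_8 -> 'I_(msum m).+1} <-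
      enum [pred n : {ffun 'I_8 -> 'I_(msum m).+1} | [forall i, (n i <= m i)%N]]].

Lemma below_uniq m : uniq (below m).
Proof.
rewrite map_inj_uniq ?enum_uniq // => n n' /ffunP e.
by apply/ffunP => i; apply: val_inj; have := e i; rewrite !ffunE.
Qed.

Lemma mem_below m n : (n \in below m) = [forall i, (n i <= m i)%N].
Proof.
apply/mapP/forallP => [[n'] | le_nm].
  by rewrite mem_enum inE => /forallP le -> i; rewrite ffunE.
have lt i : (n i < (msum m).+1)%N.
  by rewrite ltnS (leq_trans (le_nm i)) // /msum (bigD1 i) //= leq_addr.
exists [ffun i => Ordinal (lt i)]; last by apply/ffunP => i; rewrite !ffunE.
by rewrite mem_enum inE; apply/forallP => i; rewrite ffunE; exact: le_nm.
Qed.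

Lemma subsum_below m (f : mono -> W) : subsum m f = \sum_(n <- below m) f n.
Proof.
rewrite /below big_map big_enum /subsum.
apply: eq_bigr => n _.
by congr f; apply/funext => i; rewrite ffunE.
Qed.

Lemma subsumE (m : mono) (f : mono -> W) (s : seq {ffun 'I_8 -> nat}) :
  uniq s -> (forall n : {ffun 'I_8 -> nat}, (n \in s) = [forall i, (n i <= m i)%N]) ->
  subsum m f = \sum_(n <- s) f n.
Proof.
move=> us ms; rewrite subsum_below; apply: perm_big; apply: uniq_perm => //.
  exact: below_uniq.
by move=> n; rewrite mem_below ms.
Qed.

Lemma conv_mono0 f g : conv f g (fun=> 0%N) = b (f (fun=> 0%N)) (g (fun=> 0%N)).
Proof.
rewrite /conv (@subsumE _ _ [:: [ffun=> 0%N]]) //.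
  by rewrite big_seq1; congr (b (f _) (g _)); apply/funext => i; rewrite /msub ?ffunE.
move=> n; rewrite inE; apply/eqP/forallP => [-> i|le0]; first by rewrite ffunE.
by apply/ffunP => i; rewrite ffunE; apply/eqP; rewrite -leqn0.
Qed.

(* Leibniz rule: the factor m_i + 1 is split as n_i + (m_i + 1 - n_i). *)
Lemma sderiv_conv i f g :
  sderiv i (conv f g) = conv (sderiv i f) g + conv f (sderiv i g).
Proof.
apply/funext => m; rewrite !fctE /sderiv /conv !subsum_below.
set m' := madd m (eunit i).
have m'i : m' i = (m i).+1 by rewrite /m' /madd /eunit eqxx addn1.
have m'j j : j != i -> m' j = m j by rewrite /m' /madd /eunit => /negbTE ->; rewrite addn0.
pose t n := b (f n) (g (msub m' n)).
pose up (n : {ffun 'I_8 -> nat}) : {ffun 'I_8 -> nat} := [ffun j => n j + eunit i j]%N.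
have up_inj : injective up.
  by move=> n n' /ffunP e; apply/ffunP => j; have := e j; rewrite !ffunE => /addIn.
have upE n : (up n : mono) = madd n (eunit i) by apply/funext => j; rewrite ffunE.
have -> : (m i).+1%:R *: (\sum_(n <- below m') t n) =
    \sum_(n <- below m') (n i)%:R *: t n
    + \sum_(n <- below m') ((m i).+1 - n i)%:R *: t n.
  rewrite scaler_sumr -big_split /= big_seq [RHS]big_seq; apply: eq_bigr => n.
  rewrite mem_below => /forallP /(_ i); rewrite m'i => le.
  by rewrite -scalerDl -natrD subnKC.
congr (_ + _).
- rewrite (bigID (fun n : {ffun 'I_8 -> nat} => n i == 0%N)) /= big1 => [|n /eqP ->];
  last by rewrite scale0r.
  rewrite add0r -big_filter.
  have pe : perm_eq [seq n : {ffun 'I_8 -> nat} <- below m' | n i != 0%N] [seq up n | n <- below m].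
    apply: uniq_perm => [||n]; [exact: filter_uniq (below_uniq _) | by rewrite (map_inj_uniq
      up_inj) below_uniq |].
    rewrite mem_filter mem_below; apply/andP/mapP => [[n0 /forallP le]|[n']].
      exists [ffun j => n j - eunit i j]%N.
        rewrite mem_below; apply/forallP => j; rewrite ffunE /eunit; case: eqP => [->|/eqP ne].
          by have := le i; rewrite m'i; lia.
        by rewrite subn0 -m'j.
      apply/ffunP => j; rewrite !ffunE /eunit; case: eqP => [->|_]; last by rewrite subn0 addn0.
      by rewrite subnK // lt0n.
    rewrite mem_below => /forallP le ->; split; first by rewrite ffunE /eunit eqxx addn1.
    by apply/forallP => j; rewrite ffunE /m' /madd leq_add2r.
  rewrite (perm_big _ pe) big_map; apply: eq_bigr => n _; rewrite ffunE /eunit eqxx addn1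
    -/(eunit i) bZl /t upE.
    by congr (_ *: b _ (g _)); apply/funext => j; rewrite /msub /m' /madd subnDr.
- rewrite (bigID (fun n : {ffun 'I_8 -> nat} => n i == (m i).+1)) /= big1 => [|n /eqP ->];
  last first.
    by rewrite subnn scale0r.
  rewrite add0r -big_filter.
  have pe : perm_eq [seq n : {ffun 'I_8 -> nat} <- below m' | n i != (m i).+1] (below m).
    apply: uniq_perm => [||n]; [exact: filter_uniq (below_uniq _) | exact: below_uniq |].
    rewrite mem_filter !mem_below; apply/andP/forallP => [[ne /forallP le] j|le].
      case: (eqVneq j i) => [->|nj]; last by rewrite -m'j.
      by have := le i; rewrite m'i leq_eqVlt (negbTE ne).
    split; first by rewrite neq_ltn ltnS le.
    apply/forallP => j; rewrite (leq_trans (le j)) // /m' /madd leq_addr //.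
  rewrite (perm_big _ pe) big_seq [RHS]big_seq; apply: eq_bigr => n;
    rewrite mem_below => /forallP le.
    rewrite bZr /t; congr (_ *: b _ (g _)).
      by rewrite /msub subSn.
    apply/funext => j; rewrite /msub /m' /madd /eunit.
    by case: eqP => [->|_]; rewrite ?addn0 // !addn1 subSn.
Qed.

End Convolution.

Section SeriesCalculus.
Variables (K : numFieldType) (L : lmodType K).
Implicit Types (f g : mono -> L) (m : mono) (i j : 'I_8).

Lemma sderivL i (c : K) f g : sderiv i (c *: f + g) = c *: sderiv i f + sderiv i g.
Proof.
by apply/funext => m; rewrite !fctE /sderiv /= scalerDr !scalerA mulrC.
Qed.

Lemma smulvarL i (c : K) f g : smulvar i (c *: f + g) = c *: smulvar i f + smulvar i g.
Proof.
by apply/funext => m; rewrite !fctE /smulvar; case: ifP => // _; rewrite scaler0 addr0.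
Qed.

Lemma sderivC i j f : sderiv i (sderiv j f) = sderiv j (sderiv i f).
Proof.
apply/funext => m; rewrite /sderiv !scalerA.
have -> : madd (madd m (eunit i)) (eunit j) = madd (madd m (eunit j)) (eunit i).
  by apply/funext => k; rewrite /madd addnAC.
congr (_ *: _); rewrite /madd /eunit; case: (eqVneq i j) => [->|_] //.
by rewrite mulrC !addn0.
Qed.

Lemma smulvarC i j f : smulvar i (smulvar j f) = smulvar j (smulvar i f).
Proof.
case: (eqVneq i j) => [->//|ne]; have ne' : j != i by rewrite eq_sym.
apply/funext => m; rewrite /smulvar /msub /eunit (negbTE ne) (negbTE ne') !subn0.
case: ifP => _; case: ifP => _ //; congr (f _); apply/funext => k.
by rewrite subnAC.
Qed.

(** The Weyl relation: the commutator of a derivative and a variable is a Kronecker delta. *)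
Lemma sderiv_smulvar i j f : sderiv i (smulvar j f) =
  smulvar j (sderiv i f) + (if i == j then f else 0).
Proof.
apply/funext => m; rewrite /sderiv /smulvar !fctE /madd.
case: (eqVneq i j) => [<-|ne].
  rewrite {1}/eunit eqxx addn1 /=.
  have -> : msub (fun k => (m k + eunit i k)%N) (eunit i) = m.
    by apply/funext => k; rewrite /msub addnK.
  case: ifP => [m0|/negbT]; last first.
    by rewrite -eqn0Ngt => /eqP ->; rewrite add0r scale1r.
  have -> : (fun k => (msub m (eunit i) k + eunit i k)%N) = m.
    apply/funext => k; rewrite /msub subnK // /eunit; case: eqP => [->|] //.
  rewrite /msub /eunit eqxx subn1 prednK //.
  by rewrite -{3}[f m]scale1r -scalerDl -natr1.
rewrite addr0; have ei : eunit i j = 0%N by rewrite /eunit eq_sym (negbTE ne).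
have ej : eunit j i = 0%N by rewrite /eunit (negbTE ne).
rewrite ei addn0; case: ifP => m0; last by rewrite scaler0.
rewrite /msub ej subn0; congr (_ *: f _).
apply/funext => k; rewrite /eunit; case: (eqVneq k j) => [->|_]; last by rewrite !subn0.
by rewrite eq_sym (negbTE ne) !addn0.
Qed.

(** This is where characteristic zero enters: a coefficient of positive degree is recovered from a
    derivative. With [mono_ind], an identity of series reduces to its constant term and to the
    differentiated identities. *)
Lemma sderiv_scaled i f m :
  f (madd m (eunit i)) = (m i).+1%:R^-1 *: sderiv i f m.
Proof. by rewrite /sderiv scalerA mulVf ?pnatr_eq0 // scale1r. Qed.

Lemma mono_ind (P : mono -> Prop) :
  P (fun=> 0%N) -> (forall i m, P m -> P (madd m (eunit i))) -> forall m, P m.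
Proof.
move=> P0 PS m; move: {2}(msum m) (erefl (msum m)) => n; elim: n m => [|n IH] m.
  move=> m0; have -> // : m = fun=> 0%N.
  apply/funext => i; apply/eqP; rewrite -leqn0 -m0 /msum (bigD1 i) //= leq_addr //.
move=> mS; have [i mi] : exists i, (0 < m i)%N.
  case: (pickP (fun i => (0 < m i)%N)) => [i|no]; first by exists i.
  by move: mS; rewrite /msum big1 // => i _; apply/eqP; rewrite eqn0Ngt no.
have e : m = madd (msub m (eunit i)) (eunit i).
  by apply/funext => k; rewrite /madd /msub subnK // /eunit; case: eqP => [->|].
rewrite e; apply: PS; apply: IH; apply: (@addIn 1%N); rewrite !addn1 -mS /msum.
rewrite (bigD1 i) //= [in RHS](bigD1 i) //= /msub /eunit eqxx.
rewrite (eq_bigr (fun j => m j)); first by lia.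
by move=> j /negbTE ->; rewrite subn0.
Qed.

End SeriesCalculus.

Section ConvolutionShift.
Variables (K : numFieldType) (U V W : lmodType K) (b : U -> V -> W).
Hypothesis bL : forall (c : K) x y z, b (c *: x + y) z = c *: b x z + b y z.
Hypothesis bR : forall (c : K) x y z, b x (c *: y + z) = c *: b x y + b x z.

(** After differentiation by the Leibniz rule and the Weyl relation, the same claim reappears one
    degree lower for the differentiated factors. *)
Lemma conv_smulvarl i f g : conv b (smulvar i f) g = smulvar i (conv b f g).
Proof.
apply/funext => m; elim/mono_ind: m f g => [|j m IH] f g.
  by rewrite conv_mono0; exact: (lin0 (fun c x y => bL c x y _)).
rewrite !sderiv_scaled (sderiv_conv bL bR) !sderiv_smulvar (sderiv_conv bL bR).
rewrite (linD (@smulvarL _ _ i)) (linD (fun c x y => convL bL c x y g)) !fctE !IH.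
by case: ifP => _; rewrite ?(lin0 (fun c x y => convL bL c x y g)) addrAC.
Qed.

Lemma conv_smulvarr i f g : conv b f (smulvar i g) = smulvar i (conv b f g).
Proof.
apply/funext => m; elim/mono_ind: m f g => [|j m IH] f g.
  by rewrite conv_mono0; exact: (lin0 (fun c x y => bR c _ x y)).
rewrite !sderiv_scaled (sderiv_conv bL bR) !sderiv_smulvar (sderiv_conv bL bR).
rewrite (linD (@smulvarL _ _ i)) (linD (fun c x y => convR bR c f x y)) !fctE !IH.
by case: ifP => _; rewrite ?(lin0 (fun c x y => convR bR c f x y)) addrA.
Qed.
End ConvolutionShift.

Lemma series0E (K : numFieldType) (L : lmodType K) (m : mono) : (0 : mono -> L) m = 0.
Proof. by []. Qed.

Section SeriesBracket.
Variables (K : numFieldType) (L : lmodType K) (br : L -> L -> L).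
Hypothesis brP : lie_axioms br.

Lemma sbr_lie : lie_axioms (sbr br).
Proof.
case: brP => bL bR b0 bJ.
have LL := @convL _ _ _ _ _ bL; have RR := @convR _ _ _ _ _ bR.
have Ld := sderiv_conv bL bR.
have -> : sbr br = conv br by [].
split.
- by move=> c x y z; rewrite LL.
- by move=> c x y z; rewrite RR.
(* The derivative of a square is not a square, so the induction is run on the polarized identity and
   2 is divided out. *)
- suff alt f g : conv br f g + conv br g f = 0.
    move=> x; have := alt x x.
    rewrite -mulr2n -scaler_nat => /(congr1 (fun v => 2%:R^-1 *: v)).
    by rewrite scaler0 scalerA mulVf ?pnatr_eq0 // scale1r.
  apply/funext => m; elim/mono_ind: m f g => [|j m IH] f g; rewrite !fctE.
    rewrite !conv_mono0; set u := f _; set v := g _.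
    have := b0 (u + v); rewrite (linD (fun c x y => bL c x y _)).
    by rewrite !(linD (fun c x y => bR c _ x y)) !b0 add0r addr0.
  rewrite !series0E !sderiv_scaled !Ld !fctE.
  have := IH (sderiv j f) g; have := IH f (sderiv j g); rewrite !fctE !series0E => e2 e1.
  modlin0 K L ((m j).+1%:R^-1 ** e1 +++ (m j).+1%:R^-1 ** e2).
- move=> x y z; apply/funext => m.
  elim/mono_ind: m x y z => [|j m IH] x y z; rewrite !fctE.
    by rewrite !conv_mono0 bJ.
  rewrite !series0E !sderiv_scaled !Ld !fctE.
  do 3![rewrite (linD (fun c u v => RR c _ u v))].
  have := IH (sderiv j x) y z; have := IH x (sderiv j y) z; have := IH x y (sderiv j z).
  rewrite !fctE !series0E => e3 e2 e1; set k := (m j).+1%:R^-1.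
  modlin0 K L (k ** e1 +++ k ** e2 +++ k ** e3).
Qed.
End SeriesBracket.

(** * Multiplication by the Taylor expansion of F *)

Section TaylorOperator.
Variables (K : numFieldType) (L : lmodType K) (ak : nat -> K).

Definition spartial (n : nat) (f : mono -> L) : mono -> L := sderiv (vr n) f.
Definition sshift (n : nat) (f : mono -> L) : mono -> L := smulvar (vr n) f.

Definition taylor_mono (e : nat -> nat) : mono -> K :=
  fun n => if (n (vr 0) == 0%N) && (n (vr 1) == 0%N) then
     \prod_(r < 6) ('C(e r, n (vr (r + 2)))%:R * ak r ^+ (e r - n (vr (r + 2))))
   else 0.

Lemma vr_eq (i j : nat) : (i < 8)%N -> (j < 8)%N -> (vr i == vr j) = (i == j).
Proof. by move=> i8 j8; rewrite -val_eqE /= !inordK. Qed.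

(** Coefficientwise form of (x + y)^(e+1) = (x + y) (x + y)^e. *)
Lemma binom_pascal (e n : nat) (x : K) :
  'C(e.+1, n)%:R * x ^+ (e.+1 - n) =
  x * ('C(e, n)%:R * x ^+ (e - n)) +
  (if (0 < n)%N then 'C(e, n.-1)%:R * x ^+ (e - n.-1) else 0).
Proof.
case: n => [|n] /=; first by rewrite !bin0 !subn0 exprS; ring.
rewrite binS natrD mulrDl subSS; congr (_ + _).
(* For [e < n.+1] subtraction truncates and the powers disagree, but the binomial is zero. *)
case: (leqP n.+1 e) => [le|lt]; last by rewrite bin_small // !mul0r mulr0.
have -> : (e - n = (e - n.+1).+1)%N by lia.
by rewrite exprS; ring.
Qed.

(** Multiplying a monomial by u_r multiplies its expansion by a_r plus the corresponding local
    variable. [K^o] makes scalar series instances of module-valued ones. *)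
Lemma taylor_mono_shift (e e' : nat -> nat) (r : nat) : (r < 6)%N ->
  e' r = (e r).+1 -> (forall k, k != r -> e' k = e k) ->
  taylor_mono e' = ak r *: (taylor_mono e : mono -> K^o)
                  + smulvar (vr (r + 2)) (taylor_mono e : mono -> K^o).
Proof.
move=> r6 er ek; have r8 : (r + 2 < 8)%N by lia.
apply/funext => n; rewrite !fctE /smulvar /taylor_mono.
have mE k : (k < 8)%N -> k != (r + 2)%N ->
    msub n (eunit (vr (r + 2))) (vr k) = n (vr k).
  by move=> k8 nk; rewrite /msub /eunit vr_eq // (negbTE nk) subn0.
rewrite !mE //; try lia.
case: ifP => _; last by rewrite scaler0 if_same addr0.
have sp (F : 'I_6 -> K) :
    \prod_(i < 6) F i = F (Ordinal r6) * \prod_(i < 6 | i != Ordinal r6) F i.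
  by rewrite (bigD1 (Ordinal r6)).
rewrite !sp /= er binom_pascal.
have -> : msub n (eunit (vr (r + 2))) (vr (r + 2)) = (n (vr (r + 2))).-1.
  by rewrite /msub /eunit eqxx subn1.
have rest (h : mono) : (forall k, (k < 8)%N -> k != (r + 2)%N -> h (vr k) = n (vr k)) ->
  \prod_(i < 6 | i != Ordinal r6) ('C(e i, h (vr (i + 2)))%:R * ak i ^+ (e i - h (vr (i + 2))))
  = \prod_(i < 6 | i != Ordinal r6) ('C(e' i, n (vr (i + 2)))%:R * ak i ^+ (e' i - n (vr (i + 2)))).
  move=> hE; apply: eq_bigr => i ne; have nei : i != r :> nat by rewrite -val_eqE in ne.
  by rewrite ek // hE // ?eqn_add2r //; have := ltn_ord i; lia.
rewrite (rest n) // (rest (msub n (eunit (vr (r + 2))))) //.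
case: ifP => _; rewrite ?addr0 /GRing.scale /=; ring.
Qed.

Definition sone : mono -> K := fun m => if msum m == 0%N then 1 else 0.

Lemma taylor_mono0 e : (forall r, e r = 0%N) -> taylor_mono e = sone.
Proof.
move=> e0; apply/funext => n; rewrite /taylor_mono /sone.
have -> : (msum n == 0)%N = [forall i, n i == 0%N].
  by rewrite /msum sum_nat_eq0.
have vE (i : 'I_8) : i = vr i by apply: val_inj; rewrite /= inordK.
case: (boolP ((n (vr 0) == 0%N) && (n (vr 1) == 0%N))) => [/andP[/eqP n0 /eqP n1]|no]; last first.
  by case: ifP => // /forallP all0; rewrite !(eqP (all0 _)) in no.
case: ifP => [/forallP all0|/negbT].
  by rewrite big1 // => r _; rewrite e0 (eqP (all0 _)) bin0 mul1r expr0.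
rewrite negb_forall => /existsP[i ni].
have i2 : (2 <= i)%N.
  case: (ltnP i 2) => // lt2; move: ni; rewrite (vE i).
  by case: (nat_of_ord i) lt2 => [|[|k]] //; rewrite ?n0 ?n1.
have r6 : (i - 2 < 6)%N by have := ltn_ord i; lia.
rewrite (bigD1 (Ordinal r6)) //= e0 subnK // -vE.
by case: (n i) ni => // k _; rewrite bin0n mul0r mul0r.
Qed.

Lemma taylorE (P : upoly K) :
  taylor P ak = fun n => \sum_(ce <- P) ce.1 * taylor_mono ce.2 n.
Proof.
apply/funext => n; rewrite /taylor /taylor_mono; case: ifP => //= _.
by rewrite big1 // => ce _; rewrite mulr0.
Qed.

Implicit Types f : mono -> L.
Let scL (c : K) (x y : K^o) (z : L) : (c *: x + y) *: z = c *: (x *: z) + y *: z.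
Proof. by rewrite scalerDl scalerA. Qed.
Let scR (c : K) (x : K^o) (y z : L) : x *: (c *: y + z) = c *: (x *: y) + x *: z.
Proof. by rewrite scalerDr !scalerA mulrC. Qed.

Lemma smulpoly_conv (P : mono -> K) f : smulpoly P f = conv (fun (k : K^o) (v : L) => k *: v) P f.
Proof. by []. Qed.

Lemma smulpoly_one f : smulpoly sone f = f.
Proof.
have d1 i : sderiv i (sone : mono -> K^o) = 0.
  apply/funext => m; rewrite /sderiv /sone [msum _]/msum (bigD1 i) //= /madd /eunit eqxx addn1.
  by rewrite addSn /= scaler0.
rewrite smulpoly_conv; apply/funext => m; elim/mono_ind: m f => [|j m IH] f.
  by rewrite conv_mono0 /sone /msum big1 // scale1r.
rewrite !sderiv_scaled (sderiv_conv scL scR) d1 (lin0 (fun c x y => convL scL c x y f)) add0r.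
by rewrite IH.
Qed.

Definition mul_u (k : nat) f : mono -> L := ak k *: f + sshift k.+2 f.

Lemma smulpoly_taylor_mono_shift e e' r f : (r < 6)%N ->
  e' r = (e r).+1 -> (forall k, k != r -> e' k = e k) ->
  smulpoly (taylor_mono e') f = mul_u r (smulpoly (taylor_mono e) f).
Proof.
move=> r6 er ek; rewrite !smulpoly_conv (taylor_mono_shift r6 er ek) (convL scL) addn2.
by rewrite (conv_smulvarl scL scR).
Qed.

Definition Fop (al be : K) f : mono -> L :=
  mul_u 5 f + (4%:R * al - 6%:R * be) *: mul_u 1 (mul_u 2 f)
  + (8%:R * al - 2%:R * be) *: mul_u 0 (mul_u 3 f)
  + (- (20%:R * al * be)) *: mul_u 0 (mul_u 0 (mul_u 1 f)).

Lemma smulpoly_Fpoly al be f : smulpoly (taylor (Fpoly al be) ak) f = Fop al be f.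
Proof.
rewrite taylorE /Fpoly.
have -> : (fun n => \sum_(ce <- Fpoly al be) ce.1 * taylor_mono ce.2 n) =
  (1 : K) *: (taylor_mono (ex [:: 0; 0; 0; 0; 0; 1]%N) : mono -> K^o)
  + ((4%:R * al - 6%:R * be) *: (taylor_mono (ex [:: 0; 1; 1]%N) : mono -> K^o)
  + ((8%:R * al - 2%:R * be) *: (taylor_mono (ex [:: 1; 0; 0; 1]%N) : mono -> K^o)
  + ((- (20%:R * al * be)) *: (taylor_mono (ex [:: 2; 1]%N) : mono -> K^o) + 0))).
  by apply/funext => n; rewrite /Fpoly !big_cons big_nil.
rewrite smulpoly_conv !(convL scL) (lin0 (fun c x y => convL scL c x y f)) -!smulpoly_conv.
have sh e r e' := @smulpoly_taylor_mono_shift e e' r f.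
have ex0 : forall r, ex [::] r = 0%N by move=> r; rewrite /ex nth_nil.
have t0 : smulpoly (taylor_mono (ex [::])) f = f by rewrite taylor_mono0 // smulpoly_one.
have exs s : forall k, ex (0%N :: s) k = if k is k'.+1 then ex s k' else 0%N by case.
rewrite (sh (ex [::]) 5 (ex [:: 0; 0; 0; 0; 0; 1]%N)) //; last by do 6![case=> //]; move=> n;
  rewrite /ex /= nth_nil.
rewrite (sh (ex [:: 0; 0; 1]%N) 1 (ex [:: 0; 1; 1]%N)) //; last by do 3![case=> //].
rewrite (sh (ex [::]) 2 (ex [:: 0; 0; 1]%N)) //; last by do 3![case=> //]; move=> n;
  rewrite /ex /= nth_nil.
rewrite (sh (ex [:: 0; 0; 0; 1]%N) 0 (ex [:: 1; 0; 0; 1]%N)) //; last by do 4![case=> //].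
rewrite (sh (ex [::]) 3 (ex [:: 0; 0; 0; 1]%N)) //; last by do 4![case=> //]; move=> n;
  rewrite /ex /= nth_nil.
rewrite (sh (ex [:: 1; 1]%N) 0 (ex [:: 2; 1]%N)) //; last by do 2![case=> //].
rewrite (sh (ex [:: 0; 1]%N) 0 (ex [:: 1; 1]%N)) //; last by do 2![case=> //].
rewrite (sh (ex [::]) 1 (ex [:: 0; 1]%N)) //; last by do 2![case=> //]; move=> n;
  rewrite /ex /= nth_nil.
by rewrite t0 scale1r addr0 /Fop !addrA.
Qed.

End TaylorOperator.

Section ZeroCurvatureOperator.
Variables (K : numFieldType) (al be : K) (ak : nat -> K).
Variables (L : lmodType K) (br : L -> L -> L).
Variables (gA : nat -> nat -> nat -> L)
          (gB : nat -> nat -> nat -> nat -> nat -> nat -> nat -> L).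

Definition zc_op (A B : mono -> L) : mono -> L :=
  spartial 0 B
  + (mul_u ak 1 (spartial 2 B) + mul_u ak 2 (spartial 3 B) + mul_u ak 3 (spartial 4 B)
     + mul_u ak 4 (spartial 5 B) + mul_u ak 5 (spartial 6 B))
  - (spartial 1 A + Fop ak al be (spartial 2 A)) + sbr br A B.

Lemma zc_coefE : zc_coef al be ak br gA gB = zc_op (Aser gA) (Bser gB).
Proof.
apply/funext => m; rewrite /zc_coef /zc_op smulpoly_Fpoly !big_ord_recr big_ord0 /=.
by rewrite !fctE add0r.
Qed.

End ZeroCurvatureOperator.

(** * Series as a Lie algebra with derivations d i and multiplications X i *)

(* inord sends the indices above 7 to 0. *)
Definition var_index (i : nat) : nat := if i is _.+4.+4 then 0%N else i.
Definition kron (S : nmodType) (i j : nat) (f : S) : S :=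
  if Nat.eqb (var_index i) (var_index j) then f else 0.
Arguments kron : simpl nomatch.

(** Isolating these rules lets the zero-curvature calculus run by rewriting, without opening
    coefficients. *)
Record series_algebra (K : numFieldType) (S : lmodType K) (br : S -> S -> S)
    (d X : nat -> S -> S) : Prop := SeriesAlgebra {
  sa_brL : forall (c : K) x y z, br (c *: x + y) z = c *: br x z + br y z;
  sa_brR : forall (c : K) x y z, br x (c *: y + z) = c *: br x y + br x z;
  sa_br_alt : forall x, br x x = 0;
  sa_jacobi : forall x y z, br x (br y z) + br y (br z x) + br z (br x y) = 0;
  sa_dL : forall i (c : K) x y, d i (c *: x + y) = c *: d i x + d i y;
  sa_XL : forall i (c : K) x y, X i (c *: x + y) = c *: X i x + X i y;
  sa_dC : forall i j x, d i (d j x) = d j (d i x);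
  sa_XC : forall i j x, X i (X j x) = X j (X i x);
  sa_dX : forall i j x, d i (X j x) = X j (d i x) + kron i j x;
  sa_dbr : forall i x y, d i (br x y) = br (d i x) y + br x (d i y);
  sa_brXl : forall i x y, br (X i x) y = X i (br x y);
  sa_brXr : forall i x y, br x (X i y) = X i (br x y)
}.

Section SeriesAlgebraInstance.
Variables (K : numFieldType) (L : lmodType K) (br : L -> L -> L).
Hypothesis brP : lie_axioms br.

Lemma vr_var_index i : vr i = vr (var_index i).
Proof.
do 8![case: i => [//|i]]; apply: val_inj => /=; rewrite [RHS]inordK //.
by rewrite /vr /inord val_insubd.
Qed.

Lemma series_is_algebra : series_algebra (sbr br) (@spartial K L) (@sshift K L).
Proof.
have [bL bR b0 bJ] := sbr_lie brP; have [cL cR _ _] := brP.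
split=> //; rewrite /spartial /sshift.
- by move=> i; exact: sderivL.
- by move=> i; exact: smulvarL.
- by move=> i j; exact: sderivC.
- by move=> i j; exact: smulvarC.
- move=> i j f; rewrite sderiv_smulvar [vr i]vr_var_index [vr j]vr_var_index vr_eq; last 2 first.
  + by do 8![case: i => [//|i]].
  + by do 8![case: j => [//|j]].
  by rewrite /kron; case: PeanoNat.Nat.eqb_spec => [->|/eqP/negbTE ->]; rewrite ?eqxx.
- by move=> i f g; exact: (sderiv_conv cL cR).
- by move=> i f g; exact: (conv_smulvarl cL cR).
- by move=> i f g; exact: (conv_smulvarr cL cR).
Qed.
End SeriesAlgebraInstance.

Section LieCalculus.
Variables (K : numFieldType) (S : lmodType K) (br : S -> S -> S) (d X : nat -> S -> S).
Hypothesis SA : series_algebra br d X.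

Let brLl z := fun c x y => sa_brL SA c x y z.
Let brLr x := fun c y z => sa_brR SA c x y z.

Lemma brDl x y z : br (x + y) z = br x z + br y z. Proof. exact: linD (brLl z) _ _. Qed.
Lemma brDr x y z : br x (y + z) = br x y + br x z. Proof. exact: linD (brLr x) _ _. Qed.
Lemma brNl x z : br (- x) z = - br x z. Proof. exact: linN (brLl z) _. Qed.
Lemma brNr x z : br x (- z) = - br x z. Proof. exact: linN (brLr x) _. Qed.
Lemma brZl c x z : br (c *: x) z = c *: br x z. Proof. exact: linZ (brLl z) _ _. Qed.
Lemma brZr c x z : br x (c *: z) = c *: br x z. Proof. exact: linZ (brLr x) _ _. Qed.
Lemma br0l z : br 0 z = 0. Proof. exact: lin0 (brLl z). Qed.
Lemma br0r x : br x 0 = 0. Proof. exact: lin0 (brLr x). Qed.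
Definition brE := (br0l, br0r, brDl, brDr, brNl, brNr, brZl, brZr).

Lemma br_anti x y : br y x = - br x y.
Proof.
apply/eqP; rewrite -addr_eq0; apply/eqP.
by have := sa_br_alt SA (x + y); rewrite !brE !(sa_br_alt SA) add0r addr0 addrC.
Qed.
Lemma br_leibniz x y z : br x (br y z) = br (br x y) z + br y (br x z).
Proof.
have := sa_jacobi SA x y z.
rewrite [br z x]br_anti [br z _]br_anti brNr => e.
modlin0 K S (1 ** e).
Qed.

Lemma dD i x y : d i (x + y) = d i x + d i y. Proof. exact: linD (sa_dL SA i) _ _. Qed.
Lemma dN i x : d i (- x) = - d i x. Proof. exact: linN (sa_dL SA i) _. Qed.
Lemma dZ i c x : d i (c *: x) = c *: d i x. Proof. exact: linZ (sa_dL SA i) _ _. Qed.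
Lemma d0 i : d i 0 = 0. Proof. exact: lin0 (sa_dL SA i). Qed.
Definition dE := (d0, dD, dN, dZ).

Lemma XD i x y : X i (x + y) = X i x + X i y. Proof. exact: linD (sa_XL SA i) _ _. Qed.
Lemma XN i x : X i (- x) = - X i x. Proof. exact: linN (sa_XL SA i) _. Qed.
Lemma XZ i c x : X i (c *: x) = c *: X i x. Proof. exact: linZ (sa_XL SA i) _ _. Qed.
Lemma X0 i : X i 0 = 0. Proof. exact: lin0 (sa_XL SA i). Qed.
Definition XE := (X0, XD, XN, XZ).
End LieCalculus.

(** * The zero-curvature equation as a power series in u_0, ..., u_5 *)

Section TotalDerivative.
Variables (K : numFieldType) (S : lmodType K) (br : S -> S -> S) (d X : nat -> S -> S).
Hypothesis SA : series_algebra br d X.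
Variables (al be : K) (ak : nat -> K).

(* Multiplication by u_k, since X_{k+2} multiplies by u_k - a_k; locked so that the linearity
   rules for d, X and br do not see through it. *)
Definition jet (k : nat) (f : S) : S := locked (ak k *: f + X k.+2 f).
Lemma jetE k f : jet k f = ak k *: f + X k.+2 f.
Proof. by rewrite /jet -lock. Qed.
Definition jetF (f : S) : S :=
  jet 5 f + (4%:R * al - 6%:R * be) *: jet 1 (jet 2 f)
  + (8%:R * al - 2%:R * be) *: jet 0 (jet 3 f)
  + (- (20%:R * al * be)) *: jet 0 (jet 0 (jet 1 f)).

Lemma jetL k (c : K) x y : jet k (c *: x + y) = c *: jet k x + jet k y.
Proof.
by rewrite !jetE (sa_XL SA); mod0 K S.
Qed.
Lemma jetC i j x : jet i (jet j x) = jet j (jet i x).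
Proof.
by rewrite !jetE !(XE SA) (sa_XC SA i.+2 j.+2); mod0 K S.
Qed.
Lemma d_jet i k x : d i (jet k x) = jet k (d i x) + kron i k.+2 x.
Proof. by rewrite !jetE (sa_dL SA) (sa_dX SA) addrA. Qed.
Lemma br_jetl k x y : br (jet k x) y = jet k (br x y).
Proof. by rewrite !jetE (sa_brL SA) (sa_brXl SA). Qed.
Lemma br_jetr k x y : br x (jet k y) = jet k (br x y).
Proof. by rewrite !jetE (sa_brR SA) (sa_brXr SA). Qed.
Lemma jet0 k : jet k 0 = 0. Proof. exact: lin0 (jetL k). Qed.
Lemma jetD k x y : jet k (x + y) = jet k x + jet k y. Proof. exact: linD (jetL k) _ _. Qed.
Lemma jetN k x : jet k (- x) = - jet k x. Proof. exact: linN (jetL k) _. Qed.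
Lemma jetZ k c x : jet k (c *: x) = c *: jet k x. Proof. exact: linZ (jetL k) _ _. Qed.

Variables A B : S.
Hypotheses (A3 : d 3 A = 0) (A4 : d 4 A = 0) (A5 : d 5 A = 0) (A6 : d 6 A = 0) (A7 : d 7 A = 0).
Hypothesis B7 : d 7 B = 0.

(* D_x + ad A on series that do not involve u_5. *)
Definition cov (f : S) : S :=
  locked (d 0 f + (jet 1 (d 2 f) + jet 2 (d 3 f) + jet 3 (d 4 f) + jet 4 (d 5 f) + jet 5 (d 6 f))
  + br A f).
Lemma covE f : cov f =
  d 0 f + (jet 1 (d 2 f) + jet 2 (d 3 f) + jet 3 (d 4 f) + jet 4 (d 5 f) + jet 5 (d 6 f))
  + br A f.
Proof. by rewrite /cov -lock. Qed.

Lemma covL (c : K) x y : cov (c *: x + y) = c *: cov x + cov y.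
Proof.
rewrite !covE !(sa_dL SA) !jetL (sa_brR SA).
modnf K S jet jetL jetC coef_field.
Qed.
Lemma cov0 : cov 0 = 0. Proof. exact: lin0 covL. Qed.
Lemma covD x y : cov (x + y) = cov x + cov y. Proof. exact: linD covL _ _. Qed.
Lemma covN x : cov (- x) = - cov x. Proof. exact: linN covL _. Qed.
Lemma covZ c x : cov (c *: x) = c *: cov x. Proof. exact: linZ covL _ _. Qed.

Lemma cov_br x y : cov (br x y) = br (cov x) y + br x (cov y).
Proof.
rewrite !covE !(sa_dbr SA) !(brE SA).
rewrite !br_jetl !br_jetr !jetD (br_leibniz SA A x y).
modnf K S jet jetL jetC coef_field.
Qed.

(** The commutator of the u_k-derivative with D_x is the u_(k-1)-derivative. For k = 0 only the
    bracket term contributes, since the coefficients of D_x start at u_1. *)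
Lemma d2_cov f : d 2 (cov f) = cov (d 2 f) + br (d 2 A) f.
Proof.
rewrite !covE !(dE SA) !d_jet /kron /= (sa_dbr SA) (sa_dC SA 2 0) (sa_dC SA 2 3)
  (sa_dC SA 2 4) (sa_dC SA 2 5) (sa_dC SA 2 6).
modnf K S jet jetL jetC coef_field.
Qed.
Lemma d3_cov f : d 3 (cov f) = cov (d 3 f) + d 2 f.
Proof.
rewrite !covE !(dE SA) !d_jet /kron /= (sa_dbr SA) A3 (br0l SA) (sa_dC SA 3 0) (sa_dC SA 3 2)
  (sa_dC SA 3 4) (sa_dC SA 3 5) (sa_dC SA 3 6).
modnf K S jet jetL jetC coef_field.
Qed.
Lemma d4_cov f : d 4 (cov f) = cov (d 4 f) + d 3 f.
Proof.
rewrite !covE !(dE SA) !d_jet /kron /= (sa_dbr SA) A4 (br0l SA) (sa_dC SA 4 0) (sa_dC SA 4 2)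
  (sa_dC SA 4 3) (sa_dC SA 4 5) (sa_dC SA 4 6).
modnf K S jet jetL jetC coef_field.
Qed.
Lemma d5_cov f : d 5 (cov f) = cov (d 5 f) + d 4 f.
Proof.
rewrite !covE !(dE SA) !d_jet /kron /= (sa_dbr SA) A5 (br0l SA) (sa_dC SA 5 0) (sa_dC SA 5 2)
  (sa_dC SA 5 3) (sa_dC SA 5 4) (sa_dC SA 5 6).
modnf K S jet jetL jetC coef_field.
Qed.
Lemma d6_cov f : d 6 (cov f) = cov (d 6 f) + d 5 f.
Proof.
rewrite !covE !(dE SA) !d_jet /kron /= (sa_dbr SA) A6 (br0l SA) (sa_dC SA 6 0) (sa_dC SA 6 2)
  (sa_dC SA 6 3) (sa_dC SA 6 4) (sa_dC SA 6 5).
modnf K S jet jetL jetC coef_field.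
Qed.
Lemma d7_cov f : d 7 (cov f) = cov (d 7 f) + d 6 f.
Proof.
rewrite !covE !(dE SA) !d_jet /kron /= (sa_dbr SA) A7 (br0l SA) (sa_dC SA 7 0) (sa_dC SA 7 2)
  (sa_dC SA 7 3) (sa_dC SA 7 4) (sa_dC SA 7 5) (sa_dC SA 7 6).
modnf K S jet jetL jetC coef_field.
Qed.

(** The bound on [k] reflects that [cov] contains no derivative in u_5. *)
Lemma cov_jet k f : (k < 5)%N -> cov (jet k f) = jet k (cov f) + jet k.+1 f.
Proof.
case: k => [|[|[|[|[|k]]]]] // _; rewrite !covE !d_jet /kron /= !br_jetr !jetD ?jet0;
  modnf K S jet jetL jetC coef_field.
Qed.

Definition dcov := (d2_cov, d3_cov, d4_cov, d5_cov, d6_cov, d7_cov).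
Definition covlin := (cov0, covD, covN, covZ).
Definition jetlin := (jet0, jetD, jetN, jetZ).

Hypothesis zc : cov B = d 1 A + jetF (d 2 A).

Local Notation A' := (d 2 A).
Local Notation A'' := (d 2 (d 2 A)).
Let dk_d2 k f : d k f = 0 -> d k (d 2 f) = 0.
Proof. by move=> e; rewrite (sa_dC SA) e (d0 SA). Qed.
Let dA' : (d 3 A' = 0) * (d 4 A' = 0) * (d 5 A' = 0) * (d 6 A' = 0) * (d 7 A' = 0).
Proof. by do !split; apply: dk_d2. Qed.
Let dA'' : (d 3 A'' = 0) * (d 4 A'' = 0) * (d 5 A'' = 0) * (d 6 A'' = 0) * (d 7 A'' = 0).
Proof. by do !split; apply: dk_d2; rewrite dA'. Qed.
Let dtA k : d k A = 0 -> d k (d 1 A) = 0.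
Proof. by move=> e; rewrite (sa_dC SA) e (d0 SA). Qed.
Let dtA_ := (dtA A3, dtA A4, dtA A5, dtA A6, dtA A7).

Local Notation c1 := (4%:R * al - 6%:R * be).
Local Notation c := (8%:R * al - 2%:R * be).

(** Differentiating [zc] in u_k leaves one new unknown, the derivative of [B] in u_(k-1). The five
    lemmas from here to [d2B] descend from k = 5 to k = 1. *)
Lemma d6B : d 6 B = A'.
Proof.
have := congr1 (d 7) zc.
rewrite d7_cov B7 cov0 add0r /jetF !(dE SA) dtA_ !d_jet /kron /= !dA' !(addr0, jet0).
by move=> ->; mod0 K S.
Qed.
Lemma d5B : d 5 B = - cov A'.
Proof.
have := congr1 (d 6) zc.
rewrite d6_cov d6B /jetF !(dE SA) dtA_ !d_jet /kron /= !dA' !(addr0, jet0) => e.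
by modlin K S jet jetL jetC (1 ** e).
Qed.
Lemma d4B : d 4 B = c *: jet 0 A' + cov (cov A').
Proof.
have := congr1 (d 5) zc.
rewrite d5_cov d5B /jetF !(dE SA) dtA_ !d_jet /kron /= !dA' !(addr0, jet0) !covlin => e.
by modlin K S jet jetL jetC (1 ** e).
Qed.
Lemma d3B : d 3 B = c1 *: jet 1 A' - c *: cov (jet 0 A') - cov (cov (cov A')).
Proof.
have := congr1 (d 4) zc.
rewrite d4_cov d4B /jetF !(dE SA) dtA_ !d_jet /kron /= !dA' !(addr0, jet0) !covlin => e.
by modlin K S jet jetL jetC (1 ** e).
Qed.
Lemma d2B : d 2 B = c1 *: jet 2 A' - (20%:R * al * be) *: jet 0 (jet 0 A') - cov (d 3 B).
Proof.
have := congr1 (d 3) zc.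
rewrite d3_cov /jetF !(dE SA) dtA_ !d_jet /kron /= !dA' !(addr0, jet0) => e.
by modlin K S jet jetL jetC (1 ** e).
Qed.

Lemma cov_A'' : cov A'' = 0.
Proof.
(* The two mixed derivatives are 2 [cov A''] and -3 [cov A''], whence the factor 5. *)
have := sa_dC SA 3 4 B; rewrite d4B d3B !(dE SA) !(dcov, d_jet, dE SA, covlin) /kron /=.
rewrite !dA' !(jetlin, covlin, addr0, add0r, sa_br_alt SA) => e.
by modlin K S jet jetL jetC (5%:R^-1 ** e).
Qed.
Lemma d2_A'' : d 2 A'' = 0.
Proof. by have := congr1 (d 3) cov_A''; rewrite dcov dA'' covlin add0r (d0 SA). Qed.
Lemma br_A'_A'' : br A' A'' = 0.
Proof. by have := congr1 (d 2) cov_A''; rewrite dcov d2_A'' covlin add0r (d0 SA). Qed.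

(** [C] is a series in x and t alone; the split makes the dependence of [cov A'] on u_1 explicit. *)
Let ex_C : exists2 C, cov A' = C + jet 1 A'' &
  ((d 2 C = 0) * (d 3 C = 0) * (d 4 C = 0) * (d 5 C = 0) * (d 6 C = 0) * (d 7 C = 0))%type.
Proof.
exists (cov A' - jet 1 A''); first by rewrite subrK.
rewrite !(dE SA) !dcov !d_jet /kron /= !dA' !dA'' d2_A'' cov_A'' (sa_br_alt SA) !(covlin, jet0).
rewrite !(addr0, add0r) ?subrr ?oppr0; do !split; exact: subrr.
Qed.

Lemma A''_eq0 : 6%:R * al + be != 0 -> A'' = 0 /\
  5%:R *: br A' (cov (cov A')) + (20%:R * al) *: cov A' = 0.
Proof.
move=> nz; have [C covA' dC] := ex_C.
have covC2 : cov (cov A') = cov C + jet 2 A''.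
  by rewrite covA' covD cov_jet // cov_A'' jet0 add0r.
have brC : br A'' C = 0.
  have := congr1 cov br_A'_A''; rewrite cov_br cov_A'' cov0 (br0r SA) addr0 covA' (brDl SA)
    br_jetl (sa_br_alt SA) jet0 addr0.
  by rewrite (br_anti SA) => /eqP; rewrite oppr_eq0 => /eqP.
(* Equality of the mixed derivatives of [B] in u_0 and u_1. *)
have E : 3%:R *: jet 1 (br A'' C) + 5%:R *: br A' (cov C)
    + (6%:R * c - 3%:R * c1) *: jet 1 A'' + (20%:R * al) *: C = 0.
  have D3 : d 3 B = c1 *: jet 1 A' - c *: (jet 0 (C + jet 1 A'') + jet 1 A') - (cov (cov C) +
    jet 3 A'').
    by rewrite d3B covC2 covD !cov_jet // cov_A'' covA' jet0 add0r.
  have D2 : d 2 B = c1 *: jet 2 A' - (20%:R * al * be) *: jet 0 (jet 0 A') -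
     (c1 *: (jet 1 (C + jet 1 A'') + jet 2 A')
      - c *: (jet 0 (cov C + jet 2 A'') + jet 1 (C + jet 1 A'') + (jet 1 (C + jet 1 A'') + jet 2
        A'))
      - (cov (cov (cov C)) + jet 4 A'')).
    rewrite d2B D3 !covlin !cov_jet // !covlin !cov_jet // cov_A'' covA' !jetlin.
    modnf K S jet jetL jetC coef_field.
  have := sa_dC SA 2 3 B; rewrite D2 D3 !(dE SA) !(dcov, d_jet, dE SA) /kron /= !dC.
  rewrite !(dcov, covlin, dC) !(dA', dA'', d2_A'', br_A'_A'').
  rewrite !(cov_br, covA', covlin) (brDl SA) br_jetl (sa_br_alt SA) => e.
  by modlin K S jet jetL jetC ((-1) ** e).
(* The u_1-derivative of [E] leaves 6 c - 3 c1 = 6 (6 al + be) times A''. *)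
have A0 : A'' = 0.
  have := congr1 (d 3) E; rewrite brC jet0 scaler0 add0r !(dE SA) (sa_dbr SA) dcov d_jet /kron
    /= !(dC, dA', dA'').
  rewrite !(covlin, jet0, addr0, add0r, br0l SA, br0r SA) => e; apply: (scalerI nz).
  by modlin K S jet jetL jetC (6%:R^-1 ** e).
split=> //; rewrite covC2 covA' A0 !jet0 !addr0.
by move: E; rewrite brC A0 jet0 !scaler0 addr0 add0r.
Qed.
End TotalDerivative.

(** * The Lie algebra generated by the x-derivatives of dA/du_0 *)

Section JetAlgebra.
Variables (K : numFieldType) (S : lmodType K) (br : S -> S -> S) (d X : nat -> S -> S).
Hypothesis SA : series_algebra br d X.
Variables (al be a0 : K) (P : nat -> S) (Dt : S -> S).
Hypothesis d0P : forall k, d 0 (P k) = P k.+1.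
Hypothesis DtL : forall (c : K) x y, Dt (c *: x + y) = c *: Dt x + Dt y.
Hypothesis Dt_br : forall x y, Dt (br x y) = br (Dt x) y + br x (Dt y).
Hypothesis Dt_d0 : forall x, Dt (d 0 x) = d 0 (Dt x).
Hypothesis P0P2 : br (P 0) (P 2) = - (4%:R * al) *: P 1.
Hypothesis P0H : br (P 0) (br (P 0) (P 1)) = 0.
Hypothesis P1P3 : br (P 1) (P 3) + 3%:R *: br (P 0) (P 4) =
  (2%:R * be) *: P 3 + (16%:R * al * (6%:R * al + be) * a0) *: P 1.
Hypothesis DtP : Dt (P 0) =
  P 5 + ((8%:R * al - 2%:R * be) * a0) *: P 3 - (20%:R * al * be * a0 ^+ 2) *: P 1.
Hypotheses (ab : al + be != 0) (ab6 : 6%:R * al + be != 0) (ab16 : 16%:R * al + be != 0).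

Local Notation a := (4%:R * al).
Local Notation k0 := (8%:R * al * a0).
Local Notation la := (- (2%:R / 5%:R) * (6%:R * al + be)).
Local Notation p := (- (4%:R / 5%:R) * (al + be)).
Local Notation H := (br (P 0) (P 1)).
Definition central_jet : S := locked (br (P 0) (P 1) + a *: P 0).
Lemma central_jetE : central_jet = br (P 0) (P 1) + a *: P 0.
Proof. by rewrite /central_jet -lock. Qed.
Local Notation Q := central_jet.

Ltac lincomb c := by modlin0 K S c.

Let d0H : d 0 H = - a *: P 1.
Proof. by rewrite (sa_dbr SA) !d0P (sa_br_alt SA) add0r. Qed.

Lemma d0_central : d 0 Q = 0.
Proof. by rewrite central_jetE !(dE SA) d0H d0P scaleNr addNr. Qed.

Lemma central_br k : br Q (P k) = 0.
Proof.
elim: k => [|k IH].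
  by rewrite central_jetE !(brE SA) (br_anti SA) P0H (sa_br_alt SA) scaler0 oppr0 addr0.
by have := congr1 (d 0) IH; rewrite (sa_dbr SA) d0_central (br0l SA) add0r d0P (d0 SA).
Qed.

Let central_br_br x y : br Q x = 0 -> br Q y = 0 -> br Q (br x y) = 0.
Proof. by move=> ex ey; rewrite (br_leibniz SA) ex ey (br0l SA) (br0r SA) addr0. Qed.

(** ad H and - a ad P_0 differ by ad Q; this is what lets iterated brackets collapse below. *)
Let brH x : br Q x = 0 -> br H x = - a *: br (P 0) x.
Proof. rewrite central_jetE !(brE SA) => e; lincomb (1 ** e). Qed.

Let P1P2 : br (P 1) (P 2) = - a *: P 2 - br (P 0) (P 3).
Proof.
have := congr1 (d 0) P0P2; rewrite (sa_dbr SA) (dE SA) !d0P => e; lincomb (1 ** e).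
Qed.
(** [P_0, [P_1, P_2]] is evaluated by the Jacobi identity and by [P1P2]; the terms a^2 P_1
    cancel. *)
Lemma brP0P0P3 : br (P 0) (br (P 0) (P 3)) = 0.
Proof.
have e1 : br (P 0) (br (P 1) (P 2)) = (a * a) *: P 1.
  rewrite (br_leibniz SA) (brH (central_br 2)) P0P2 !(brE SA) (sa_br_alt SA).
  mod0 K S.
have := congr1 (br (P 0)) P1P2; rewrite !(brE SA) e1 P0P2 => e.
lincomb (1 ** e).
Qed.
Let P1P3' : 2%:R *: br (P 1) (P 3) + br (P 0) (P 4) = - a *: P 3.
Proof.
have := congr1 (d 0) P1P2; rewrite !(dE SA) !(sa_dbr SA) !d0P (sa_br_alt SA) => e; lincomb (1 ** e).
Qed.

(** [P1P3] and [P1P3'] are two linear equations, of determinant 5, for [P_1, P_3] and [P_0, P_4].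
    Their solutions, the second after adding k0 [P_0, P_2], are multiples of this one combination,
    with factors [la] and [- p]. *)
Local Notation V := (P 3 + k0 *: P 1).
Local Notation V1 := (P 4 + k0 *: P 2).
Local Notation V2 := (P 5 + k0 *: P 3).

Let P1V : br (P 1) V = la *: V.
Proof.
rewrite !(brE SA) (sa_br_alt SA); lincomb ((3%:R / 5%:R) ** P1P3' +++ (- 1 / 5%:R) ** P1P3).
Qed.
Let P0V1 : br (P 0) V1 = - p *: V.
Proof.
rewrite !(brE SA) P0P2; lincomb ((- 1 / 5%:R) ** P1P3' +++ (2%:R / 5%:R) ** P1P3).
Qed.
Let P0W : br (P 0) (br (P 0) V) = 0.
Proof.
by rewrite !(brE SA) brP0P0P3 P0H scaler0 addr0.
Qed.

Let P0V2 : br (P 0) V2 = - p *: V1 - br (P 1) V1.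
Proof.
have := congr1 (d 0) P0V1; rewrite (sa_dbr SA) !(dE SA) !d0P => e.
lincomb (1 ** e).
Qed.
Let P2V : br (P 2) V = la *: V1 - br (P 1) V1.
Proof.
have := congr1 (d 0) P1V; rewrite (sa_dbr SA) !(dE SA) !d0P => e.
lincomb (1 ** e).
Qed.

Let QV1 : br Q V1 = 0.
Proof. by rewrite !(brE SA) !central_br scaler0 addr0. Qed.
Let QV2 : br Q V2 = 0.
Proof. by rewrite !(brE SA) !central_br scaler0 addr0. Qed.

(** Mixed Leibniz terms of [P_0, P_1] under the fifth and third x-derivatives: the terms 10
    [P_2, P_4] and 5 [P_4, P_2] combine, while [P_3, P_3] and [P_2, P_2] vanish. *)
Local Notation anomaly := (5%:R *: br (P 1) (P 5) + 5%:R *: br (P 2) (P 4)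
  + (3%:R * (8%:R * al - 2%:R * be) * a0) *: br (P 1) (P 3)).

(* Dt acts on the P k as a polynomial in the derivation d 0, and d 0 kills Q,
   so Dt Q only collects the mixed terms of the Leibniz formula. *)
Let Dt_central : Dt Q = - anomaly.
Proof.
have e2 : 2%:R *: br (P 1) (P 3) + br (P 0) (P 4) = - a *: P 3 := P1P3'.
have e3 := congr1 (d 0) e2; rewrite !(dE SA) !(sa_dbr SA) !d0P in e3.
have e4 := congr1 (d 0) e3; rewrite !(dE SA) !(sa_dbr SA) !d0P in e4.
rewrite central_jetE (linD DtL) (linZ DtL) Dt_br -d0P Dt_d0 DtP !(dE SA) !d0P !(brE SA).
rewrite (br_anti SA (P 1) (P 5)) (br_anti SA (P 1) (P 3)) (sa_br_alt SA) P0P2.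
have e5 := sa_br_alt SA (P 3).
lincomb (1 ** e4 +++ ((8%:R * al - 2%:R * be) * a0) ** e2 +++ (- 2%:R) ** e5).
Qed.

(** Apply [Dt] to [Q, P_0] = 0: the term [Q, Dt P_0] vanishes because Dt P_0 is a combination of the
    P_k. *)
Let P0_anomaly : br (P 0) anomaly = 0.
Proof.
have := congr1 Dt (central_br 0).
rewrite Dt_br Dt_central DtP (lin0 DtL) => e.
have : br Q (P 5 + ((8%:R * al - 2%:R * be) * a0) *: P 3 - (20%:R * al * be * a0 ^+ 2) *: P 1) = 0.
  by rewrite !(brE SA) !central_br !scaler0 oppr0 !addr0.
move=> e'; rewrite e' addr0 (brNl SA) -(br_anti SA) in e.
exact: e.
Qed.

(** This is [P_0, anomaly] = 0 with P_5 and P_4 expressed through [V2] and [V1]. *)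
Let P1P1V1 : br (P 1) (br (P 1) V1) = (p * (a - la)) *: V1
  + ((3%:R * (8%:R * al - 2%:R * be) * a0 - 5%:R * k0) * la / 5%:R) *: br (P 0) V.
Proof.
have eR : anomaly = 5%:R *: br (P 1) V2 + 5%:R *: br (P 2) V1
    + ((3%:R * (8%:R * al - 2%:R * be) * a0 - 5%:R * k0) * la) *: V.
  have := P1V; rewrite !(brE SA) !(sa_br_alt SA) => e.
  lincomb ((3%:R * (8%:R * al - 2%:R * be) * a0 - 5%:R * k0) ** e).
have e12 : br (P 0) (br (P 1) V2) = (a * p) *: V1 + a *: br (P 1) V1 - p *: br (P 1) V1
    - br (P 1) (br (P 1) V1).
  rewrite (br_leibniz SA (P 0) (P 1) V2) (brH QV2) P0V2.
  rewrite (brDr SA (P 1) (- p *: V1)) (brZr SA _ (P 1)) (brNr SA (P 1)).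
  set w := br (P 1) V1; mod0 K S.
have e21 : br (P 0) (br (P 2) V1) = - a *: br (P 1) V1 - p *: (la *: V1 - br (P 1) V1).
  rewrite (br_leibniz SA (P 0) (P 2) V1) P0P2 P0V1 (brZl SA) (brZr SA _ (P 2)) P2V.
  by mod0 K S.
have := P0_anomaly; rewrite eR (brDr SA (P 0) (_ + _)) (brDr SA (P 0) (_ *: _)) !(brZr SA _ (P
  0)) e12 e21 => e.
lincomb ((- 1 / 5%:R) ** e).
Qed.

(** A second bracket with P_0 kills the last term of [P1P1V1] by [P0W] and makes the rest a multiple
    of V. Since la - a + p = 3 la, what remains is 3 p (a - la) la V = 0. *)
Lemma jet3_eq : P 3 = - k0 *: P 1.
Proof.
have eN : br (P 0) (br (P 1) V1) = (p * (a - la)) *: V.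
  rewrite (br_leibniz SA (P 0) (P 1) V1) (brH QV1) P0V1 (brZr SA) P1V.
  mod0 K S.
have := congr1 (br (P 0)) P1P1V1.
rewrite (br_leibniz SA (P 0) (P 1) (br (P 1) V1)) brH; last first.
  exact: central_br_br (central_br 1) QV1.
rewrite eN (brZr SA _ (P 1)) P1V (brDr SA (P 0) (_ *: _)) !(brZr SA _ (P 0)) P0W P0V1 => e.
have nz : p * (a - la) * la != 0.
  have -> : p * (a - la) * la = (16%:R / 125%:R) * ((al + be) * (6%:R * al + be) * (16%:R * al +
    be)).
    by field.
  by rewrite !mulf_neq0 ?invr_eq0 ?pnatr_eq0.
have V0 : V = 0.
  apply: (scalerI nz); rewrite scaler0.
  lincomb ((1 / 3%:R) ** e).
lincomb (1 ** V0).
Qed.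

Lemma Dt_central0 : Dt Q = 0.
Proof.
have e4 : P 4 = - k0 *: P 2 by rewrite -d0P jet3_eq (dE SA) d0P.
have e5 : P 5 = - k0 *: (- k0 *: P 1) by rewrite -d0P e4 (dE SA) d0P jet3_eq.
rewrite Dt_central e5 e4 jet3_eq !(brE SA) !(sa_br_alt SA); mod0 K S.
Qed.
End JetAlgebra.

(** * Explicit solution for B *)

Section ExplicitFlux.
Variables (K : numFieldType) (S : lmodType K) (br : S -> S -> S) (d X : nat -> S -> S).
Hypothesis SA : series_algebra br d X.
Variables (al be : K) (ak : nat -> K) (P : nat -> S).
Hypothesis d0P : forall k, d 0 (P k) = P k.+1.
Hypothesis dkP : forall i k, (2 <= i < 8)%N -> d i (P k) = 0.
Hypothesis P0P2 : br (P 0) (P 2) = - (4%:R * al) *: P 1.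
Hypothesis P0H : br (P 0) (br (P 0) (P 1)) = 0.

Local Notation a := (4%:R * al).
Local Notation c1 := (4%:R * al - 6%:R * be).
Local Notation c := (8%:R * al - 2%:R * be).
Local Notation H := (br (P 0) (P 1)).
Local Notation jet := (jet X ak).
Local Notation A := (X 2 (P 0)).
Local Notation cov := (cov br d X ak A).

(** An antiderivative of the u_k-derivatives of [B] that are forced when A = (u_0 - a_0) P_0; [B]
    can differ from it only by a series in x and t. *)
Definition flux : S :=
  jet 4 (P 0) - jet 3 (P 1) + jet 2 (P 2 + X 2 H + c *: jet 0 (P 0))
  - (1 / 2%:R) *: jet 1 (jet 1 (H + (c - c1) *: P 0))
  - jet 1 (P 3 + c *: jet 0 (P 1) - (2%:R * a) *: X 2 (P 1))
  + X 2 (P 4 + (c * ak 0) *: P 2 - (20%:R * al * be * ak 0 ^+ 2) *: P 0)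
  + (1 / 2%:R) *: X 2 (X 2 (br (P 0) (P 3) - (2%:R * be) *: P 2 + (c * ak 0) *: H
                            - (40%:R * al * be * ak 0) *: P 0))
  - (1 / 3%:R) *: X 2 (X 2 (X 2 ((2%:R * be) *: H + (20%:R * al * be) *: P 0))).

Let dP k : (d 2 (P k) = 0) * (d 3 (P k) = 0) * (d 4 (P k) = 0) * (d 5 (P k) = 0)
  * (d 6 (P k) = 0) * (d 7 (P k) = 0).
Proof. by do !split; apply: dkP. Qed.
Let d0H : d 0 H = - a *: P 1.
Proof. by rewrite (sa_dbr SA) !d0P (sa_br_alt SA) add0r. Qed.
Let dbrP i j k : (2 <= i < 8)%N -> d i (br (P j) (P k)) = 0.
Proof. by move=> ir; rewrite (sa_dbr SA) !dkP // (br0l SA) (br0r SA) addr0. Qed.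
Let dB j k : (d 2 (br (P j) (P k)) = 0) * (d 3 (br (P j) (P k)) = 0) * (d 4 (br (P j) (P k)) = 0)
  * (d 5 (br (P j) (P k)) = 0) * (d 6 (br (P j) (P k)) = 0) * (d 7 (br (P j) (P k)) = 0).
Proof. by do !split; apply: dbrP. Qed.

Ltac expand_by tac :=
  rewrite ?(jetE, XE SA, scalerDr, scalerN) ?(dE SA);
  rewrite ?(sa_dX SA, dE SA, dP, dB, d0P, d0H) /kron /=; tac;
  modnf K S X (sa_XL SA) (sa_XC SA) coef_field.

Lemma d7_flux : d 7 flux = 0.
Proof. by rewrite /flux; expand_by idtac. Qed.
Lemma d6_flux : d 6 flux = P 0.
Proof. by rewrite /flux; expand_by idtac. Qed.
Lemma d5_flux : d 5 flux = - P 1.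
Proof. by rewrite /flux; expand_by idtac. Qed.
Lemma d4_flux : d 4 flux = P 2 + X 2 H + c *: jet 0 (P 0).
Proof. by rewrite /flux; expand_by idtac. Qed.
Lemma d3_flux : d 3 flux = - jet 1 (H + (c - c1) *: P 0)
  - (P 3 + c *: jet 0 (P 1) - (2%:R * a) *: X 2 (P 1)).
Proof. by rewrite /flux; expand_by idtac. Qed.
Lemma d2_flux : d 2 flux = jet 2 (H + c *: P 0) - jet 1 ((c - 2%:R * a) *: P 1)
  + (P 4 + (c * ak 0) *: P 2 - (20%:R * al * be * ak 0 ^+ 2) *: P 0)
  + X 2 (br (P 0) (P 3) - (2%:R * be) *: P 2 + (c * ak 0) *: H - (40%:R * al * be * ak 0) *: P 0)
  - X 2 (X 2 ((2%:R * be) *: H + (20%:R * al * be) *: P 0)).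
Proof. by rewrite /flux; expand_by idtac. Qed.

(** The remainder is the evolution equation in degree one in u_0 - a_0 and the relation for
    [P_1, P_3] + 3 [P_0, P_4] in degree two. It serves both to extract these equations from a
    solution and to verify the model. *)
Lemma cov_flux : cov flux - (d 1 A + jetF X al be ak (P 0)) =
  X 2 (P 5 + (c * ak 0) *: P 3 - (20%:R * al * be * ak 0 ^+ 2) *: P 1 - d 1 (P 0))
  + (1 / 2%:R) *: X 2 (X 2 (br (P 1) (P 3) + 3%:R *: br (P 0) (P 4)
      - (2%:R * be) *: P 3 - (16%:R * al * (6%:R * al + be) * ak 0) *: P 1)).
Proof.
have d0P0P3 : d 0 (br (P 0) (P 3)) = br (P 1) (P 3) + br (P 0) (P 4).
  by rewrite (sa_dbr SA) !d0P.
have P0P3 := brP0P0P3 SA d0P P0P2 P0H.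
rewrite covE d2_flux d3_flux d4_flux d5_flux d6_flux /jetF /flux.
expand_by ltac:(rewrite ?(brE SA, sa_brXl SA, sa_brXr SA) ?(sa_br_alt SA, P0H, P0P2, P0P3, d0P0P3)).
Qed.
End ExplicitFlux.

(** * Relations among the P_k forced by zero curvature *)

Section FluxNecessary.
Variables (K : numFieldType) (S : lmodType K) (br : S -> S -> S) (d X : nat -> S -> S).
Hypothesis SA : series_algebra br d X.
Variables (al be : K) (ak : nat -> K) (P : nat -> S) (B : S).
Hypothesis d0P : forall k, d 0 (P k) = P k.+1.
Hypothesis dkP : forall i k, (2 <= i < 8)%N -> d i (P k) = 0.

Local Notation a := (4%:R * al).
Local Notation c1 := (4%:R * al - 6%:R * be).
Local Notation c := (8%:R * al - 2%:R * be).
Local Notation H := (br (P 0) (P 1)).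
Local Notation jet := (jet X ak).
Local Notation A := (X 2 (P 0)).
Local Notation cov := (cov br d X ak A).
Local Notation flux := (flux br X al be ak P).

Hypothesis B7 : d 7 B = 0.
Hypothesis zc : cov B = d 1 A + jetF X al be ak (P 0).
Hypothesis skew : 5%:R *: br (P 0) (cov (cov (P 0))) + (20%:R * al) *: cov (P 0) = 0.

Let dP k : (d 2 (P k) = 0) * (d 3 (P k) = 0) * (d 4 (P k) = 0) * (d 5 (P k) = 0)
  * (d 6 (P k) = 0) * (d 7 (P k) = 0).
Proof. by do !split; apply: dkP. Qed.
Let dbrP i j k : (2 <= i < 8)%N -> d i (br (P j) (P k)) = 0.
Proof. by move=> ir; rewrite (sa_dbr SA) !dkP // (br0l SA) (br0r SA) addr0. Qed.
Let dB j k : (d 2 (br (P j) (P k)) = 0) * (d 3 (br (P j) (P k)) = 0) * (d 4 (br (P j) (P k)) = 0)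
  * (d 5 (br (P j) (P k)) = 0) * (d 6 (br (P j) (P k)) = 0) * (d 7 (br (P j) (P k)) = 0).
Proof. by do !split; apply: dbrP. Qed.
Let dA k : d k.+3 A = X 2 (d k.+3 (P 0)) + kron k.+3 2 (P 0).
Proof. exact: sa_dX SA _ _ _. Qed.
Let d2A : d 2 A = P 0.
Proof. by rewrite (sa_dX SA) dP /kron /= (X0 SA) add0r. Qed.
Let dA0 : (d 3 A = 0) * (d 4 A = 0) * (d 5 A = 0) * (d 6 A = 0) * (d 7 A = 0).
Proof. by do !split; rewrite dA dP /kron /= (X0 SA) addr0. Qed.
Let A3 : d 3 A = 0 := dA0.1.1.1.1.
Let A4 : d 4 A = 0 := dA0.1.1.1.2.
Let A5 : d 5 A = 0 := dA0.1.1.2.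
Let A6 : d 6 A = 0 := dA0.1.2.
Let A7 : d 7 A = 0 := dA0.2.
Let zc' : cov B = d 1 A + jetF X al be ak (d 2 A). Proof. by rewrite d2A. Qed.

Let cov_const f : (forall i, (2 <= i < 7)%N -> d i f = 0) -> cov f = d 0 f + X 2 (br (P 0) f).
Proof. by move=> df; rewrite covE !(df 2, df 3, df 4, df 5, df 6) // !(jet0 SA) !addr0 (sa_brXl
  SA). Qed.

Let covP k : cov (P k) = P k.+1 + X 2 (br (P 0) (P k)).
Proof. by rewrite cov_const ?d0P // => i /andP[i2 i7]; rewrite dkP // i2 ltnW. Qed.

(** [skew] is affine in u_0 - a_0, and the two relations are its coefficients. *)
Lemma P0P2_P0H : br (P 0) (P 2) = - a *: P 1 /\ br (P 0) H = 0.
Proof.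
have c0 : cov (P 0) = P 1 by rewrite covP (sa_br_alt SA) (X0 SA) addr0.
move: skew; rewrite c0 covP (brDr SA) (sa_brXr SA) => e.
have e2 := congr1 (d 2) e.
rewrite !(dE SA) (sa_dX SA) !(sa_dbr SA) !dP /kron /= in e2.
rewrite !(br0l SA, br0r SA, X0 SA, addr0, add0r, d0 SA, scaler0) in e2.
have PH : br (P 0) H = 0.
  by modlin0 K S (5%:R^-1 ** e2).
split=> //; rewrite PH (X0 SA) in e.
by modlin0 K S (5%:R^-1 ** e).
Qed.

Let P0P2 : br (P 0) (P 2) = - a *: P 1 := P0P2_P0H.1.
Let P0H : br (P 0) H = 0 := P0P2_P0H.2.
Let d0H : d 0 H = - a *: P 1.
Proof. by rewrite (sa_dbr SA) !d0P (sa_br_alt SA) add0r. Qed.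

Let cov0P : cov (P 0) = P 1.
Proof. by rewrite covP (sa_br_alt SA) (X0 SA) addr0. Qed.
Let cov1P : cov (P 1) = P 2 + X 2 H.
Proof. by rewrite covP. Qed.
Let cov2P : cov (P 2 + X 2 H) = P 3 - (2%:R * a) *: X 2 (P 1) + jet 1 H.
Proof.
rewrite covE !(dE SA) !(sa_dX SA) !(dP, dB, d0P, d0H) /kron /=.
rewrite !(X0 SA, addr0, add0r, jet0 SA) !(brE SA, sa_brXl SA, sa_brXr SA) P0P2 P0H !(XE SA).
modnf K S X (sa_XL SA) (sa_XC SA) coef_field.
Qed.
Let d3B_flux : d 3 B = d 3 flux.
Proof.
rewrite (d3B SA A3 A4 A5 A6 A7 B7 zc') d2A !(cov_jet SA) // cov0P cov1P cov2P.
rewrite (d3_flux SA) //.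
rewrite !(jetE, XE SA).
modnf K S X (sa_XL SA) (sa_XC SA) coef_field.
Qed.
Let cov_X2P k : cov (X 2 (P k)) = X 2 (cov (P k)) + jet 1 (P k).
Proof.
rewrite !covE !(sa_dX SA) !dP /kron /= !(X0 SA) !(addr0, add0r, jet0 SA, sa_brXl SA, sa_brXr SA).
modnf K S X (sa_XL SA) (sa_XC SA) coef_field.
Qed.
Let d2B_flux : d 2 B = d 2 flux.
Proof.
have covH : cov H = - a *: P 1.
  by rewrite (cov_br SA) cov0P cov1P (sa_br_alt SA) (brDr SA) (sa_brXr SA) P0H (X0 SA) addr0 add0r.
rewrite (d2B SA A3 A4 A5 A6 A7 zc') d3B_flux d2A (d3_flux SA) //.
rewrite !(covlin SA) !(cov_jet SA) // !(covlin SA).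
rewrite cov_X2P covH cov0P cov1P (covP 3) (d2_flux SA) //.
rewrite !(jetE, XE SA) .
modnf K S X (sa_XL SA) (sa_XC SA) coef_field.
Qed.

Definition flux_residue : S := locked (B - flux).
Local Notation R := flux_residue.
Lemma flux_residueE : B = flux + R.
Proof. by rewrite /flux_residue -lock addrC subrK. Qed.
Lemma d_flux_residue i : (2 <= i < 8)%N -> d i R = 0.
Proof.
rewrite /flux_residue -lock (linB (sa_dL SA i)).
have d6 := d6B SA A3 A4 A5 A6 A7 B7 zc'; have d5 := d5B SA A3 A4 A5 A6 A7 B7 zc'.
have d4 := d4B SA A3 A4 A5 A6 A7 B7 zc'; rewrite d2A in d4 d5 d6.
case: i => [|[|[|[|[|[|[|[|i]]]]]]]] // _; apply/eqP; rewrite subr_eq0; apply/eqP.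
- exact: d2B_flux.
- exact: d3B_flux.
- by rewrite d4 (d4_flux SA) // cov0P cov1P addrC.
- by rewrite d5 (d5_flux SA) // cov0P.
- by rewrite d6 (d6_flux SA).
- by rewrite B7 (d7_flux SA).
Qed.

Let X2_poly_eq0 f0 f1 f2 : d 2 f0 = 0 -> d 2 f1 = 0 -> d 2 f2 = 0 ->
  f0 + X 2 f1 + (1 / 2%:R) *: X 2 (X 2 f2) = 0 -> [/\ f0 = 0, f1 = 0 & f2 = 0].
Proof.
move=> df0 df1 df2 e0.
have e1 := congr1 (d 2) e0; rewrite !(dE SA, sa_dX SA) df0 df1 df2 /kron /= in e1.
rewrite !(X0 SA) !add0r in e1.
have e2 := congr1 (d 2) e1; rewrite !(dE SA, sa_dX SA) df1 df2 /kron /= !(X0 SA) in e2.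
have f20 : f2 = 0 by modlin0 K S (1 ** e2).
rewrite f20 !(X0 SA) !addr0 scaler0 addr0 in e1.
by rewrite f20 e1 !(X0 SA) scaler0 !addr0 in e0.
Qed.

(** Coefficients of degree 0, 1 and 2 in u_0 - a_0 of zero curvature for [flux + R]. By the middle
    one, [d 1] corrected by ad R acts on P_0 as a polynomial in [d 0]. *)
Lemma flux_residue_eqs : [/\ d 0 R = 0,
  d 1 (P 0) = P 5 + (c * ak 0) *: P 3 - (20%:R * al * be * ak 0 ^+ 2) *: P 1 - br R (P 0) &
  br (P 1) (P 3) + 3%:R *: br (P 0) (P 4)
    = (2%:R * be) *: P 3 + (16%:R * al * (6%:R * al + be) * ak 0) *: P 1].
Proof.
have covR : cov R = d 0 R + X 2 (br (P 0) R).
  by apply: cov_const => i /andP[i2 i7]; rewrite d_flux_residue // i2 ltnW.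
have e := zc; rewrite flux_residueE (covD SA) covR in e.
have e' := cov_flux SA be ak d0P dkP P0P2 P0H.
set E1 := _ - d 1 (P 0) in e'; set E2 := br (P 1) (P 3) + _ - _ - _ in e'.
have e0 : d 0 R + X 2 (br (P 0) R + E1) + (1 / 2%:R) *: X 2 (X 2 E2) = 0.
  rewrite (XD SA); modlin0 K S (1 ** e +++ (- 1) ** e').
have dd i j k : (2 <= i < 8)%N -> d i (d j (P k)) = 0.
  by move=> ir; rewrite (sa_dC SA) dkP // (d0 SA).
have dE1 : d 2 (br (P 0) R + E1) = 0.
  rewrite /E1 !(dE SA) !(sa_dbr SA) d_flux_residue // !dP dd // (br0l SA) (br0r SA).
  by rewrite !scaler0 !subr0 !addr0.
have dE2 : d 2 E2 = 0.
  by rewrite /E2 !(dE SA) !(sa_dbr SA) !dP !(br0l SA) !(br0r SA); mod0 K S.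
have d0R2 : d 2 (d 0 R) = 0 by rewrite (sa_dC SA) d_flux_residue // (d0 SA).
have [R0 e1 E20] := X2_poly_eq0 d0R2 dE1 dE2 e0.
split=> //.
- rewrite /E1 in e1; rewrite (br_anti SA (P 0) R).
  by modlin0 K S ((- 1) ** e1).
- rewrite /E2 in E20; by modlin0 K S (1 ** E20).
Qed.
End FluxNecessary.

(** * The structure of F^0 *)

Definition pure_time (m : mono) : Prop := forall i : 'I_8, i != vr 1 -> m i = 0%N.

Lemma mono_split (m : mono) i : (0 < m i)%N -> m = madd (msub m (eunit i)) (eunit i).
Proof.
by move=> mi; apply/funext => k; rewrite /madd /msub subnK // /eunit; case: eqP => [->|].
Qed.

(** Other variables are removed before t, so a t-step is needed only on the t-axis, where the gauge
    condition on [B] gives the value of [R]. *)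
Lemma mono_ind_time (P : mono -> Prop) :
  P (fun=> 0%N) ->
  (forall i m, i != vr 1 -> P m -> P (madd m (eunit i))) ->
  (forall m, pure_time m -> P m -> P (madd m (eunit (vr 1)))) ->
  forall m, P m.
Proof.
move=> P0 PS PT m; move: {2}(msum m) (erefl (msum m)) => n; elim: n m => [|n IH] m mS.
  have -> // : m = fun=> 0%N.
  by apply/funext => i; apply/eqP; rewrite -leqn0 -mS /msum (bigD1 i) //= leq_addr.
have sum_sub i : (0 < m i)%N -> msum (msub m (eunit i)) = n.
  move=> mi; apply: (@addIn 1%N); rewrite !addn1 -mS /msum.
  rewrite (bigD1 i) //= [in RHS](bigD1 i) //= /msub /eunit eqxx.
  rewrite (eq_bigr (fun j => m j)); first by lia.
  by move=> j /negbTE ->; rewrite subn0.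
case: (pickP (fun i => (i != vr 1) && (0 < m i)%N)) => [i /andP[i1 mi]|no].
  by rewrite (mono_split mi); apply: PS => //; apply: IH; apply: sum_sub.
have pm : pure_time m.
  by move=> i i1; apply/eqP; have := no i; rewrite i1 /= lt0n => /negbFE.
have m1 : (0 < m (vr 1))%N.
  rewrite lt0n; apply/eqP => m1; move: mS; rewrite /msum big1 // => i _.
  by case: (eqVneq i (vr 1)) => [->//|i1]; exact: pm.
rewrite (mono_split m1); apply: PT; last by apply: IH; apply: sum_sub.
by move=> i i1; rewrite /msub pm.
Qed.

Section ZeroCurvatureCov.
Variables (K : numFieldType) (al be : K) (ak : nat -> K) (L : lmodType K) (br : L -> L -> L).
Local Notation d := (@spartial K L).
Local Notation X := (@sshift K L).

Lemma mul_u_jet k f : mul_u ak k f = jet X ak k f.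
Proof. by rewrite jetE. Qed.

Lemma zc_op_cov A B : zc_op al be ak br A B =
  cov (sbr br) d X ak A B - (d 1 A + jetF X al be ak (d 2 A)).
Proof.
rewrite /zc_op /Fop !mul_u_jet covE /jetF.
by mod0 K (mono -> L).
Qed.
End ZeroCurvatureCov.

Section StructureOfF0.
Variables (K : numFieldType) (al be : K) (ak : nat -> K).
Variables (L : lmodType K) (br : L -> L -> L).
Variables (gA : nat -> nat -> nat -> L)
          (gB : nat -> nat -> nat -> nat -> nat -> nat -> nat -> L).
Hypothesis brP : lie_axioms br.
Hypothesis rel : F0_relations al be ak br gA gB.
Hypotheses (ab : al + be != 0) (ab6 : 6%:R * al + be != 0) (ab16 : 16%:R * al + be != 0).

Local Notation d := (@spartial K L).
Local Notation X := (@sshift K L).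
Local Notation sb := (sbr br).
Local Notation A := (Aser gA).
Local Notation B := (Bser gB).
Let SA : series_algebra sb d X := series_is_algebra brP.
Local Notation a := (4%:R * al).
Local Notation k0 := (8%:R * al * ak 0).
Local Notation c1 := (4%:R * al - 6%:R * be).
Local Notation c := (8%:R * al - 2%:R * be).

Lemma d_Aser i : (3 <= i < 8)%N -> d i A = 0.
Proof.
move=> /andP[i3 i8]; apply/funext => m; rewrite /spartial /sderiv /Aser.
case: ifP => [/forallP /(_ (vr i))|_]; last by rewrite scaler0.
by rewrite /vr inordK // i3 /= /madd /eunit eqxx addn1.
Qed.

Lemma d7_Bser : d 7 B = 0.
Proof.
by apply/funext => m; rewrite /spartial /sderiv /Bser /madd /eunit eqxx addn1 /= scaler0.
Qed.

Lemma zc_cov : cov sb d X ak A B = d 1 A + jetF X al be ak (d 2 A).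
Proof.
have [zc _ _] := rel; apply/eqP; rewrite -subr_eq0 -zc_op_cov -zc_coefE; apply/eqP.
by apply/funext => m; rewrite zc.
Qed.

(** The difference is independent of u_0 and vanishes at u_0 = a_0 by the gauge condition on [A]. *)
Lemma Aser_eq_shift : d 2 (d 2 A) = 0 -> A = X 2 (d 2 A).
Proof.
move=> A2; have [_ gA0 _] := rel.
apply/eqP; rewrite -subr_eq0; apply/eqP.
have dg : d 2 (A - X 2 (d 2 A)) = 0.
  by rewrite !(dE SA) (sa_dX SA) A2 (X0 SA) add0r /kron /= subrr.
apply/funext => m; case: (posnP (m (vr 2))) => [m2|m2]; last first.
  by rewrite (mono_split m2) sderiv_scaled -/(spartial 2 _) dg series0E scaler0.
rewrite !fctE /sshift /smulvar m2 /= subr0 /Aser m2 gA0.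
by case: ifP.
Qed.

Let A'' := (A''_eq0 SA (d_Aser (isT : (3 <= 3 < 8)%N)) (d_Aser (isT : (3 <= 4 < 8)%N)) 
  (d_Aser (isT : (3 <= 5 < 8)%N)) (d_Aser (isT : (3 <= 6 < 8)%N)) (d_Aser (isT : (3 <= 7 < 8)%N))
  d7_Bser zc_cov ab6).
Let P k := iter k (d 0) (d 2 A).
Let d0P k : d 0 (P k) = P k.+1. Proof. by []. Qed.
Let dkP i k : (2 <= i < 8)%N -> d i (P k) = 0.
Proof.
move=> /andP[i2 i8]; elim: k => [|k IH]; last by rewrite /= (sa_dC SA) IH (d0 SA).
case: (ltngtP i 2) i2 => // [i3|->] _; last exact: A''.1.
by rewrite /= (sa_dC SA) d_Aser ?i3 // (d0 SA).
Qed.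
Let A_P : A = X 2 (P 0). Proof. exact: Aser_eq_shift A''.1. Qed.
Let zcP : cov sb d X ak (X 2 (P 0)) B = d 1 (X 2 (P 0)) + jetF X al be ak (P 0).
Proof. by rewrite -A_P zc_cov. Qed.
Let skewP : 5%:R *: sb (P 0) (cov sb d X ak (X 2 (P 0)) (cov sb d X ak (X 2 (P 0)) (P 0)))
   + (20%:R * al) *: cov sb d X ak (X 2 (P 0)) (P 0) = 0.
Proof. by rewrite -A_P; exact: A''.2. Qed.

Let P0P2 : sb (P 0) (P 2) = - a *: P 1 := (P0P2_P0H SA d0P dkP skewP).1.
Let P0H : sb (P 0) (sb (P 0) (P 1)) = 0 := (P0P2_P0H SA d0P dkP skewP).2.
Let R := flux_residue sb X al be ak P B.
Let Dt f := d 1 f + sb R f.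
Let R_eqs := flux_residue_eqs SA d0P dkP d7_Bser zcP skewP.

(** The outcome of zero curvature, packaged so that the span argument sees [P] and [R] only through
    these equations. *)
Record jets_of_F0 (P : nat -> mono -> L) (R : mono -> L) : Prop := JetsOfF0 {
  jets_A : P 0 = d 2 A;
  jets_d0 : forall k, d 0 (P k) = P k.+1;
  jets_dk : forall i k, (2 <= i < 8)%N -> d i (P k) = 0;
  jets_02 : sb (P 0) (P 2) = - a *: P 1;
  jets_3 : P 3 = - k0 *: P 1;
  jets_B : B = flux sb X al be ak P + R;
  jets_dR : forall i, (i < 8)%N -> i != 1%N -> d i R = 0;
  jets_d1 : forall k, d 1 (P k) = P k.+3.+2 + (c * ak 0) *: P k.+3
     - (20%:R * al * be * ak 0 ^+ 2) *: P k.+1 - sb R (P k);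
  jets_Q0 : d 0 (central_jet sb al P) = 0;
  jets_Q1 : d 1 (central_jet sb al P) + sb R (central_jet sb al P) = 0;
  jets_QP : forall k, sb (central_jet sb al P) (P k) = 0
}.

Lemma F0_jets : exists P R, jets_of_F0 P R.
Proof.
have [d0R d1P P1P3] := R_eqs.
have DtL (k : K) x y : Dt (k *: x + y) = k *: Dt x + Dt y.
  rewrite /Dt (sa_dL SA) (sa_brR SA).
  by mod0 K (mono -> L).
have Dt_br x y : Dt (sb x y) = sb (Dt x) y + sb x (Dt y).
  rewrite /Dt (sa_dbr SA) (br_leibniz SA) !(brE SA).
  by mod0 K (mono -> L).
(* This holds because [R] does not depend on x. *)
have Dt_d0 x : Dt (d 0 x) = d 0 (Dt x).
  by rewrite /Dt (dE SA) (sa_dbr SA) d0R (br0l SA) add0r (sa_dC SA).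
have DtP : Dt (P 0) = P 5 + (c * ak 0) *: P 3 - (20%:R * al * be * ak 0 ^+ 2) *: P 1.
  by rewrite /Dt d1P subrK.
exists P, R; split.
- by [].
- exact: d0P.
- exact: dkP.
- exact: P0P2.
- exact: (@jet3_eq _ _ _ _ _ SA al be (ak 0) P Dt d0P DtL Dt_br Dt_d0 P0P2 P0H P1P3 DtP ab ab6
  ab16).
- exact: flux_residueE.
- case=> [|[|i]] // i8 _.
  exact: (d_flux_residue SA d0P dkP d7_Bser zcP skewP).
- elim=> [|k IH]; first exact: d1P.
  rewrite -[P k.+1]/(d 0 (P k)) (sa_dC SA) IH !(dE SA) (sa_dbr SA) d0R (br0l SA) add0r.
  by rewrite !d0P.
- exact: (@d0_central _ _ _ _ _ SA al P d0P P0P2).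
- exact: (@Dt_central0 _ _ _ _ _ SA al be (ak 0) P Dt d0P DtL Dt_br Dt_d0 P0P2 P0H P1P3 DtP ab
  ab6 ab16).
- exact: (@central_br _ _ _ _ _ SA al P d0P P0P2 P0H).
Qed.
End StructureOfF0.

(** * Gauge fixing on the t-axis and the spanning set *)

Section GaugeValue.
Variables (K : numFieldType) (al be : K) (ak : nat -> K).
Variables (L : lmodType K) (br : L -> L -> L) (P : nat -> mono -> L).
Hypothesis brP : lie_axioms br.
Hypothesis P3E : P 3 = - (8%:R * al * ak 0) *: P 1.

Local Notation X := (@sshift K L).
Local Notation sb := (sbr br).
Let SA : series_algebra sb (@spartial K L) X := series_is_algebra brP.
Local Notation a := (4%:R * al).
Local Notation k0 := (8%:R * al * ak 0).
Local Notation c1 := (4%:R * al - 6%:R * be).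
Local Notation c := (8%:R * al - 2%:R * be).
Local Notation Q := (central_jet sb al P).

(* The value of -R on the t-axis, read off from the gauge condition B(x_a, t, a) = 0. *)
Definition gauge_value : mono -> L :=
  ak 4 *: P 0 - ak 3 *: P 1 + ak 2 *: (P 2 + (c * ak 0) *: P 0)
  - (1 / 2%:R * ak 1 ^+ 2) *: (Q - a *: P 0 + (c - c1) *: P 0)
  - ak 1 *: (- k0 *: P 1 + (c * ak 0) *: P 1).

Lemma br_P0P1 : sb (P 0) (P 1) = Q - a *: P 0.
Proof. by rewrite central_jetE addrK. Qed.
Lemma br_P0P3 : sb (P 0) (P 3) = - k0 *: (Q - a *: P 0).
Proof. by rewrite P3E (brZr SA) br_P0P1. Qed.

Let sshift_time i f m : (i < 8)%N -> i != 1%N -> pure_time m -> X i f m = 0.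
Proof. by move=> i8 i1 pm; rewrite /sshift /smulvar pm // vr_eq. Qed.

Lemma flux_time m : pure_time m -> flux sb X al be ak P m = gauge_value m.
Proof.
move=> pm; have Xm_ i f : (i < 6)%N -> X i.+2 f m = 0 by move=> i6; rewrite sshift_time.
rewrite /flux br_P0P1 br_P0P3 P3E.
rewrite !(jetE, XE SA) !fctE !Xm_ // !(scaler0, addr0, subr0, oppr0).
rewrite /gauge_value !fctE.
by mod0 K L.
Qed.
End GaugeValue.

Section SpanOfF0.
Variables (K : numFieldType) (al be : K) (ak : nat -> K).
Variables (L : lmodType K) (br : L -> L -> L).
Variables (gA : nat -> nat -> nat -> L)
          (gB : nat -> nat -> nat -> nat -> nat -> nat -> nat -> L).
Hypothesis brP : lie_axioms br.
Hypothesis rel : F0_relations al be ak br gA gB.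
Variables (P : nat -> mono -> L) (R : mono -> L).
Hypothesis J : jets_of_F0 al be ak br gA gB P R.

Local Notation d := (@spartial K L).
Local Notation X := (@sshift K L).
Local Notation sb := (sbr br).
Local Notation A := (Aser gA).
Local Notation B := (Bser gB).
Let SA : series_algebra sb d X := series_is_algebra brP.
Local Notation a := (4%:R * al).
Local Notation k0 := (8%:R * al * ak 0).
Local Notation c1 := (4%:R * al - 6%:R * be).
Local Notation c := (8%:R * al - 2%:R * be).
Local Notation Q := (central_jet sb al P).
Local Notation o := ((fun=> 0%N) : mono).

Definition F0_span (x : L) : Prop := exists c0 c1 c2 c3 : K,
  x = c0 *: P 0 o + c1 *: P 1 o + c2 *: P 2 o + c3 *: Q o.

Lemma F0_span_lin (k : K) x y : F0_span x -> F0_span y -> F0_span (k *: x + y).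
Proof.
move=> [x0 [x1 [x2 [x3 ->]]]] [y0 [y1 [y2 [y3 ->]]]].
exists (k * x0 + y0), (k * x1 + y1), (k * x2 + y2), (k * x3 + y3).
mod0 K L.
Qed.
Lemma F0_span0 : F0_span 0.
Proof. exists 0, 0, 0, 0; mod0 K L. Qed.
Lemma F0_spanD x y : F0_span x -> F0_span y -> F0_span (x + y).
Proof. by move=> sx sy; rewrite -[x]scale1r; exact: F0_span_lin. Qed.
Lemma F0_spanZ k x : F0_span x -> F0_span (k *: x).
Proof. by move=> sx; rewrite -[k *: x]addr0; apply: F0_span_lin => //; exact: F0_span0. Qed.
Lemma F0_spanN x : F0_span x -> F0_span (- x).
Proof. by move=> sx; rewrite -scaleN1r; exact: F0_spanZ. Qed.

Let H_Q : sb (P 0) (P 1) = Q - a *: P 0 := br_P0P1 al br P.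
Let P0P2 := jets_02 J.
Let P0P3 : sb (P 0) (P 3) = - k0 *: (Q - a *: P 0) := br_P0P3 brP (jets_3 J).
Lemma br_P1P2 : sb (P 1) (P 2) = - a *: P 2 + k0 *: (Q - a *: P 0).
Proof.
have := congr1 (d 0) P0P2; rewrite (sa_dbr SA) (dE SA) !(jets_d0 J) P0P3 => e.
modlin0 K (mono -> L) (1 ** e).
Qed.
Let P5E : P 5 = (k0 * k0) *: P 1.
Proof.
have e4 : P 4 = - k0 *: P 2 by rewrite -(jets_d0 J) (jets_3 J) (dE SA) (jets_d0 J).
rewrite -(jets_d0 J) e4 (dE SA) (jets_d0 J) (jets_3 J).
mod0 K (mono -> L).
Qed.

Local Notation N := (gauge_value al be ak br P).
Lemma residue_time m : pure_time m -> R m = - N m.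
Proof.
move=> pm; have [_ _ gB0] := rel.
have B0 : B m = 0.
  by rewrite /Bser (pm (vr 7)) ?(pm (vr 0)) ?(pm (vr 2)) ?(pm (vr 3)) ?(pm (vr 4)) ?(pm (vr 5))
    ?(pm (vr 6))
    ?vr_eq //= gB0.
by move: B0; rewrite (jets_B J) fctE (flux_time be brP (jets_3 J) pm) addrC => /eqP;
  rewrite addr_eq0 => /eqP.
Qed.

(** A monomial in t splits only into monomials in t, so only values of [R] on the t-axis enter. *)
Lemma br_residue_time f m : pure_time m -> sb R f m = - sb N f m.
Proof.
move=> pm; suff : sb (R + N) f m = 0.
  by rewrite (brDl SA) fctE => /eqP; rewrite addr_eq0 => /eqP.
have [bL _ _ _] := brP.
rewrite /sbr /subsum big1 // => n /forallP le.
have pn : pure_time (fun i => nat_of_ord (n i)).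
  by move=> i i1; apply/eqP; have := le i; rewrite pm // leqn0.
by rewrite fctE residue_time // addNr (lin0 (fun k x y => bL k x y _)).
Qed.

Definition jets_in_span (m : mono) : Prop :=
  [/\ F0_span (P 0 m), F0_span (P 1 m), F0_span (P 2 m) & F0_span (Q m)].

Let br_N f : sb N f = (ak 4 + ak 2 * c * ak 0 - (1 / 2%:R * ak 1 ^+ 2) * (c - c1 - a)) *: sb (P 0) f
   - (ak 3 + ak 1 * (c * ak 0 - k0)) *: sb (P 1) f + ak 2 *: sb (P 2) f
   - (1 / 2%:R * ak 1 ^+ 2) *: sb Q f.
Proof. rewrite /gauge_value !(brE SA); mod0 K (mono -> L). Qed.

Let dQi i : (2 <= i < 8)%N -> d i Q = 0.
Proof.
by move=> ir; rewrite central_jetE !(dE SA) (sa_dbr SA) !(jets_dk J) // (br0l SA) (br0r SA)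
  addr0 scaler0 addr0.
Qed.

Ltac in_span :=
  repeat first [ assumption | apply: F0_spanD | apply: F0_spanN | apply: F0_spanZ | exact:
    F0_span0 ].

(** P_0, P_1, P_2, Q form a closed system: [d 0] returns to P_1 through P_3 = - k0 P_1, and on the
    t-axis [d 1] involves, besides the P_k, only brackets with [N], a constant combination of the
    same four series. *)
Lemma all_jets_in_span m : jets_in_span m.
Proof.
have QP k := jets_QP J k.
have PQ k : sb (P k) Q = 0 by rewrite (br_anti SA) QP oppr0.
elim/mono_ind_time: m => [|i m i1 [s0 s1 s2 s3]|m pm [s0 s1 s2 s3]].
- split; [exists 1, 0, 0, 0 | exists 0, 1, 0, 0 | exists 0, 0, 1, 0 | exists 0, 0, 0, 1]; mod0 K L.
- have vi : i = vr i by apply: val_inj; rewrite /= inordK.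
  have i1' : i != 1%N :> nat by apply: contra i1 => /eqP e; rewrite vi e.
  have [i0|i2] : nat_of_ord i = 0%N \/ (2 <= i < 8)%N.
    by case: i i1' {i1 vi} => [[|[|i]] ilt] /= i1'; [left|by []|right; rewrite /= ilt].
    rewrite /jets_in_span !sderiv_scaled vi i0 -!/(d 0 _) !(jets_d0 J) (jets_Q0 J) (jets_3 J) !fctE.
    by split; in_span.
  rewrite /jets_in_span !sderiv_scaled vi -!/(d i _) !(jets_dk J) // dQi //.
  by split; in_span.
- rewrite /jets_in_span !sderiv_scaled -!/(d 1 _) !(jets_d1 J).
  have -> : d 1 Q = - sb R Q by apply/eqP; rewrite -addr_eq0; apply/eqP; exact: jets_Q1 J.
  have P4E : P 4 = - k0 *: P 2 by rewrite -(jets_d0 J) (jets_3 J) (dE SA) (jets_d0 J).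
  have P6E : P 6 = (k0 * k0) *: P 2 by rewrite -(jets_d0 J) P5E (dE SA) (jets_d0 J).
  have P7E : P 7 = (k0 * k0) *: (- k0 *: P 1) by rewrite -(jets_d0 J) P6E (dE SA) (jets_d0 J)
    (jets_3 J).
  rewrite P7E P6E P5E P4E (jets_3 J) !fctE !br_residue_time // !br_N.
  have b10 : sb (P 1) (P 0) = - (Q - a *: P 0) by rewrite (br_anti SA) H_Q.
  have b20 : sb (P 2) (P 0) = a *: P 1 by rewrite (br_anti SA) P0P2 scaleNr opprK.
  have b21 : sb (P 2) (P 1) = - (- a *: P 2 + k0 *: (Q - a *: P 0)) by rewrite (br_anti SA) br_P1P2.
  rewrite !QP !PQ !(sa_br_alt SA) H_Q P0P2 br_P1P2 b10 b20 b21 !fctE !series0E.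
  by split; in_span.
Qed.

Definition in_span_series (f : mono -> L) : Prop := forall m, F0_span (f m).
Let spsD f g : in_span_series f -> in_span_series g -> in_span_series (f + g).
Proof. by move=> sf sg m; rewrite fctE; apply: F0_spanD. Qed.
Let spsZ k f : in_span_series f -> in_span_series (k *: f).
Proof. by move=> sf m; rewrite fctE; apply: F0_spanZ. Qed.
Let spsN f : in_span_series f -> in_span_series (- f).
Proof. by move=> sf m; rewrite fctE; apply: F0_spanN. Qed.
Let spsX i f : in_span_series f -> in_span_series (X i f).
Proof. by move=> sf m; rewrite /sshift /smulvar; case: ifP => _; [exact: sf | exact: F0_span0]. Qed.
Let spsJ i f : in_span_series f -> in_span_series (jet X ak i f).
Proof. by move=> sf; rewrite jetE; apply: spsD; [apply: spsZ | apply: spsX]. Qed.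
Let sps0 : in_span_series (P 0). Proof. by move=> m; case: (all_jets_in_span m). Qed.
Let sps1 : in_span_series (P 1). Proof. by move=> m; case: (all_jets_in_span m). Qed.
Let sps2 : in_span_series (P 2). Proof. by move=> m; case: (all_jets_in_span m). Qed.
Let spsQ : in_span_series Q. Proof. by move=> m; case: (all_jets_in_span m). Qed.

Ltac sps := repeat first [ exact: sps0 | exact: sps1 | exact: sps2 | exact: spsQ
  | apply: spsD | apply: spsN | apply: spsZ | apply: spsX | apply: spsJ ].

Lemma A_in_span m : F0_span (A m).
Proof.
have [_ gA0 _] := rel.
suff : F0_span (A m) by [].
case: (posnP (m (vr 2))) => m2.
  by rewrite /Aser m2 gA0 if_same; exact: F0_span0.
rewrite (mono_split m2) sderiv_scaled -/(d 2 A) -(jets_A J); apply: F0_spanZ; exact: sps0.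
Qed.

Lemma R_in_span m : F0_span (R m).
Proof.
elim/mono_ind_time: m => [|i m i1 _|m pm _].
- rewrite residue_time //; apply: F0_spanN; have: in_span_series N by rewrite /gauge_value; sps.
  exact.
- have vi : i = vr i by apply: val_inj; rewrite /= inordK.
  have i1' : i != 1%N :> nat by apply: contra i1 => /eqP e; rewrite vi e.
  by rewrite sderiv_scaled vi -/(d i _) (jets_dR J) // scaler0; exact: F0_span0.
- have pm' : pure_time (madd m (eunit (vr 1))).
    by move=> i i1; rewrite /madd /eunit (negbTE i1) addn0 pm.
  rewrite residue_time //; apply: F0_spanN; have: in_span_series N by rewrite /gauge_value; sps.
  exact.
Qed.

Lemma B_in_span m : F0_span (B m).
Proof.
rewrite (jets_B J) fctE; apply: F0_spanD; last exact: R_in_span.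
have : in_span_series (flux sb X al be ak P).
  by rewrite /flux P0P3 H_Q (jets_3 J) -(jets_d0 J 3) (jets_3 J) (dE SA) (jets_d0 J); sps.
exact.
Qed.
End SpanOfF0.

(** * Spanning set and brackets at the point a *)

Section F0Consequences.
Variables (K : numFieldType) (al be : K) (ak : nat -> K).
Variables (L : lmodType K) (br : L -> L -> L).
Variables (gA : nat -> nat -> nat -> L)
          (gB : nat -> nat -> nat -> nat -> nat -> nat -> nat -> L).
Hypothesis brP : lie_axioms br.
Hypothesis rel : F0_relations al be ak br gA gB.
Hypothesis gen : lie_generated br (is_generator gA gB).
Hypotheses (ab : al + be != 0) (ab6 : 6%:R * al + be != 0) (ab16 : 16%:R * al + be != 0).

Local Notation a := (4%:R * al).
Local Notation k0 := (8%:R * al * ak 0).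
Local Notation p0 := (gA 0 0 1).
Local Notation p1 := (gA 1 0 1).
(** The factor is 2!: P_2 at a is a second x-derivative, [gA 2 0 1] a Taylor coefficient. *)
Local Notation p2 := (2%:R *: gA 2 0 1).
Local Notation q := (br p0 p1 + a *: p0).

Let brl z : forall (c : K) x y, br (c *: x + y) z = c *: br x z + br y z.
Proof. by case: brP => + _ _ _; move=> h c x y; exact: h. Qed.
Let brr z : forall (c : K) x y, br z (c *: x + y) = c *: br z x + br z y.
Proof. by case: brP => _ + _ _; move=> h c x y; exact: h. Qed.
Let brE' := (fun z => lin0 (brl z), fun z => lin0 (brr z), fun z => linD (brl z),
  fun z => linD (brr z), fun z => linN (brl z), fun z => linN (brr z), fun z => linZ (brl z),
    fun z => linZ (brr z)).
Let br_alt x : br x x = 0. Proof. by case: brP. Qed.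
Let br_antisym x y : br y x = - br x y.
Proof.
apply/eqP; rewrite -addr_eq0; apply/eqP; have := br_alt (x + y).
by rewrite !brE' !br_alt add0r addr0 addrC.
Qed.

Let br_comb u0 u1 u2 v (x0 x1 x2 x3 y0 y1 y2 y3 : K) : br v u0 = 0 -> br v u1 = 0 -> br v u2 = 0 ->
  br (x0 *: u0 + x1 *: u1 + x2 *: u2 + x3 *: v) (y0 *: u0 + y1 *: u1 + y2 *: u2 + y3 *: v)
  = (x0 * y1 - x1 * y0) *: br u0 u1 + (x0 * y2 - x2 * y0) *: br u0 u2
    + (x1 * y2 - x2 * y1) *: br u1 u2.
Proof.
move=> v0 v1 v2; rewrite !brE' !br_alt v0 v1 v2 !(br_antisym v) v0 v1 v2.
by rewrite (br_antisym u0 u1) (br_antisym u0 u2) (br_antisym u1 u2); mod0 K L.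
Qed.

Definition monomial (s : seq nat) : mono := fun i => nth 0%N s i.

(** Taking constant coefficients respects brackets, so the relations among series specialize to a.
    The span contains the generators and is closed under the bracket, hence is everything by
    [gen]. *)
Lemma F0_structure :
  [/\ forall x, exists c0 c1 c2 c3 : K, x = c0 *: p0 + c1 *: p1 + c2 *: p2 + c3 *: q,
      br p0 p2 = - a *: p1,
      br p1 p2 = - a *: p2 + k0 *: (q - a *: p0) &
      forall x, br q x = 0].
Proof.
have [P [R J]] := F0_jets brP rel ab ab6 ab16.
have Asm m : (forall j, (2 < j < 8)%N -> m (vr j) = 0%N) -> Aser gA m = gA (m (vr 0)) (m (vr 1))
  (m (vr 2)).
  move=> m0; rewrite /Aser; case: ifP => // /negbT; rewrite negb_forall => /existsP[j].
  have vj : j = vr j by apply: val_inj; rewrite /= inordK.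
  by rewrite negb_imply => /andP[j2]; rewrite vj m0 ?j2 //=.
have e0 : P 0 (fun=> 0%N) = p0.
  rewrite (jets_A J) /spartial /sderiv scale1r Asm /madd /eunit ?vr_eq //=.
  by move=> j /andP[j2 j8]; rewrite vr_eq //; case: eqP j2 => [->|].
have e1 : P 1 (fun=> 0%N) = p1.
  rewrite -(jets_d0 J) (jets_A J) /spartial /sderiv scale1r Asm /madd /eunit ?vr_eq //= ?scale1r //.
  by move=> j /andP[j2 j8]; rewrite !vr_eq //; case: eqP j2 => [->|] //; case: eqP => [->|].
have e2 : P 2 (fun=> 0%N) = p2.
  rewrite -!(jets_d0 J) (jets_A J) /spartial /sderiv scale1r Asm /madd /eunit ?vr_eq //=
    ?scale1r //.
  by move=> j /andP[j2 j8]; rewrite !vr_eq //; case: eqP j2 => [->|] //; case: eqP => [->|].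
have br0 f g : sbr br f g (fun=> 0%N) = br (f (fun=> 0%N)) (g (fun=> 0%N)).
  exact: (conv_mono0 br f g).
have e3 : central_jet (sbr br) al P (fun=> 0%N) = q.
  by rewrite central_jetE !fctE br0 e0 e1.
have sp x : F0_span al br P x -> exists c0 c1 c2 c3 : K, x = c0 *: p0 + c1 *: p1 + c2 *: p2 + c3
  *: q.
  by rewrite /F0_span e0 e1 e2 e3.
have q0 : br q p0 = 0.
  by have := congr1 (fun f => f (fun=> 0%N)) (jets_QP J 0); rewrite /= br0 e3 e0.
have q1 : br q p1 = 0.
  by have := congr1 (fun f => f (fun=> 0%N)) (jets_QP J 1); rewrite /= br0 e3 e1.
have q2 : br q p2 = 0.
  by have := congr1 (fun f => f (fun=> 0%N)) (jets_QP J 2); rewrite /= br0 e3 e2.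
have r01 : br p0 p1 = q - a *: p0 by rewrite addrK.
have r02 : br p0 p2 = - a *: p1.
  by have := congr1 (fun f => f (fun=> 0%N)) (jets_02 J); rewrite /= br0 !fctE e0 e1 e2.
have r12 : br p1 p2 = - a *: p2 + k0 *: (q - a *: p0).
  have := congr1 (fun f => f (fun=> 0%N)) (br_P1P2 brP J).
  by rewrite /= br0 !fctE e0 e1 e2 e3.
have all x : exists c0 c1 c2 c3 : K, x = c0 *: p0 + c1 *: p1 + c2 *: p2 + c3 *: q.
  move: x; apply: gen => [x||x y|k x|x y].
  - case=> [[l1 [l2 [i0 ->]]]|[l1 [l2 [j0 [j1 [j2 [j3 [j4 ->]]]]]]]].
      have -> : gA l1 l2 i0 = Aser gA (monomial [:: l1; l2; i0]).
        rewrite Asm /monomial /vr ?inordK // => j /andP[j2 j8]; rewrite inordK //.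
        by rewrite nth_default.
      by apply: sp; exact: (A_in_span brP rel J).
    have -> : gB l1 l2 j0 j1 j2 j3 j4 = Bser gB (monomial [:: l1; l2; j0; j1; j2; j3; j4]).
      by rewrite /Bser /monomial /vr !inordK.
    by apply: sp; exact: (B_in_span brP rel J).
  - by exists 0, 0, 0, 0; mod0 K L.
  - move=> [x0 [x1 [x2 [x3 ->]]]] [y0 [y1 [y2 [y3 ->]]]].
    by exists (x0 + y0), (x1 + y1), (x2 + y2), (x3 + y3); mod0 K L.
  - move=> [x0 [x1 [x2 [x3 ->]]]].
    by exists (k * x0), (k * x1), (k * x2), (k * x3); mod0 K L.
  - move=> [x0 [x1 [x2 [x3 ->]]]] [y0 [y1 [y2 [y3 ->]]]].
    move: q0 q1 q2 r01 r02 r12; set Q := q; set Z := p2; move=> q0 q1 q2 r01 r02 r12.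
    pose w := x0 * y1 - x1 * y0; pose w' := x1 * y2 - x2 * y1.
    (* Coordinates obtained by substituting [r01], [r02] and [r12]. *)
    exists (- a * w - a * k0 * w'), (- a * (x0 * y2 - x2 * y0)), (- a * w'), (w + k0 * w').
    have E : br (x0 *: p0 + x1 *: p1 + x2 *: Z + x3 *: Q) (y0 *: p0 + y1 *: p1 + y2 *: Z + y3 *: Q)
      = w *: br p0 p1 + (x0 * y2 - x2 * y0) *: br p0 Z + w' *: br p1 Z.
      exact: br_comb.
    by rewrite E r01 r02 r12; mod0 K L.
split=> // x; have [x0 [x1 [x2 [x3 ->]]]] := all x.
by rewrite !(linD (brr q)) (linZ (brr q) x0) (linZ (brr q) x1) (linZ (brr q) x2) (linZ (brr q)
  x3) q0 q1 q2 br_alt !scaler0 !addr0.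
Qed.

End F0Consequences.

(** * A solution with values in a given Lie algebra *)

Section FlowModel.
Variables (K : numFieldType) (M : lmodType K) (br : M -> M -> M).
Hypothesis brP : lie_axioms br.
Variables (al be : K) (ak : nat -> K) (g0 e0 : M).

Local Notation d := (@spartial K M).
Local Notation X := (@sshift K M).
Local Notation sb := (sbr br).
Let SA : series_algebra sb d X := series_is_algebra brP.
Local Notation a := (4%:R * al).
Local Notation k0 := (8%:R * al * ak 0).
Local Notation c1 := (4%:R * al - 6%:R * be).
Local Notation c := (8%:R * al - 2%:R * be).
Local Notation e1 := (br g0 e0).
Local Notation e2 := (br g0 e1).
Local Notation q := (br e0 e1 + a *: e0).

(** The relations required at the point a; the flow carries them to all x and t. *)
Hypothesis E02 : br e0 e2 = - a *: e1.
Hypothesis E0H : br e0 (br e0 e1) = 0.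
Hypothesis E3 : br g0 e2 = - k0 *: e1.

Let brl z : forall (k : K) x y, br (k *: x + y) z = k *: br x z + br y z.
Proof. by case: brP => + _ _ _; move=> h k x y; exact: h. Qed.
Let brr z : forall (k : K) x y, br z (k *: x + y) = k *: br z x + br z y.
Proof. by case: brP => _ + _ _; move=> h k x y; exact: h. Qed.
Let br_alt x : br x x = 0. Proof. by case: brP. Qed.
Let br_antisym x y : br y x = - br x y.
Proof.
apply/eqP; rewrite -addr_eq0; apply/eqP; have := br_alt (x + y).
by rewrite (linD (brl _)) !(linD (brr _)) !br_alt add0r addr0 addrC.
Qed.
Let br_der x y z : br x (br y z) = br (br x y) z + br y (br x z).
Proof.
case: brP => _ _ _ jac; have := jac x y z.
rewrite (br_antisym x z) (br_antisym (br x y) z) (linN (brr y)) => e.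
modlin0 K M (1 ** e).
Qed.

(* Minus the value forced on the t-axis by the gauge condition on B. *)
Let r0 : M :=
  - (ak 4 *: e0 - ak 3 *: e1 + ak 2 *: (e2 + (c * ak 0) *: e0)
     - (1 / 2%:R * ak 1 ^+ 2) *: (q - a *: e0 + (c - c1) *: e0)
     - ak 1 *: (- k0 *: e1 + (c * ak 0) *: e1)).
(** The coefficient of P_1 left in the evolution equation by P_3 = - k0 P_1 and P_5 = k0^2 P_1,
    namely k0^2 - c a_0 k0 - 20 al be a_0^2. *)
Let speed : K := - (4%:R * al * be * ak 0 ^+ 2).
Let t0 : M := speed *: g0 - r0.

Definition xt_only (m : mono) : bool := [forall j : 'I_8, (1 < j)%N ==> (m j == 0%N)].
Definition t_only (m : mono) : bool := [forall j : 'I_8, (j != vr 1) ==> (m j == 0%N)].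

(* exp(t ad t0) exp(x ad g0) s, and exp(t ad t0) r0 below *)
Definition flow (s : M) : mono -> M := fun m =>
  if xt_only m then
    ((m (vr 0))`! * (m (vr 1))`!)%:R^-1 *: iter (m (vr 1)) (br t0) (iter (m (vr 0)) (br g0) s)
  else 0.
Definition time_flow : mono -> M := fun m =>
  if t_only m then ((m (vr 1))`!)%:R^-1 *: iter (m (vr 1)) (br t0) r0 else 0.

Let iter_lin n z (k : K) x y : iter n (br z) (k *: x + y) = k *: iter n (br z) x + iter n (br z) y.
Proof. by elim: n => //= n ->; rewrite brr. Qed.

Lemma flowL (k : K) s s' : flow (k *: s + s') = k *: flow s + flow s'.
Proof.
apply/funext => m; rewrite !fctE /flow; case: ifP => _; last by rewrite scaler0 addr0.
by rewrite !iter_lin scalerDr !scalerA mulrC.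
Qed.

Lemma xt_only_madd i m : (i < 8)%N -> xt_only (madd m (eunit (vr i))) = (i < 2)%N && xt_only m.
Proof.
move=> i8; apply/forallP/andP => [h|[i2 /forallP h] j].
  split.
    rewrite ltnNge; apply/negP => i2; have := h (vr i).
    by rewrite /vr inordK // i2 /= /madd /eunit eqxx addn1.
  apply/forallP => j; have := h j; case: (1 < j)%N => //=.
  by rewrite /madd addn_eq0 => /andP[].
apply/implyP => j1; have := h j; rewrite j1 /= /madd /eunit => /eqP ->.
case: (j =P vr i) => [ej|_] //.
by rewrite ej /vr inordK // ltnNge -ltnS i2 in j1.
Qed.

Lemma t_only_madd i m : (i < 8)%N -> t_only (madd m (eunit (vr i))) = (i == 1%N) && t_only m.
Proof.
move=> i8; apply/forallP/andP => [h|[/eqP -> /forallP h] j].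
  split.
    apply/negPn/negP => i1; have := h (vr i).
    by rewrite vr_eq // i1 /= /madd /eunit eqxx addn1.
  apply/forallP => j; have := h j; case: (j != vr 1) => //=.
  by rewrite /madd addn_eq0 => /andP[].
apply/implyP => j1; have := h j; rewrite j1 /= /madd /eunit => /eqP ->.
by rewrite (negbTE j1).
Qed.

Let fact_ratio n k : n.+1%:R * ((n.+1`! * k)%:R)^-1 = ((n`! * k)%:R)^-1 :> K.
Proof.
case: k => [|k]; first by rewrite !muln0 !invr0 mulr0.
by rewrite factS -mulnA natrM invfM mulrA mulfV ?mul1r ?pnatr_eq0.
Qed.

Lemma d0_flow s : d 0 (flow s) = flow (br g0 s).
Proof.
apply/funext => m; rewrite /spartial /sderiv /flow xt_only_madd //=; case: ifP => _;
  last by rewrite scaler0.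
rewrite /madd /eunit eqxx vr_eq //= addn0 addn1 scalerA fact_ratio.
by rewrite iterSr.
Qed.

Lemma d1_flow s : d 1 (flow s) = fun m => br t0 (flow s m).
Proof.
apply/funext => m; rewrite /spartial /sderiv /flow xt_only_madd //=; case: ifP => _; last first.
  by rewrite scaler0 (lin0 (brr t0)).
rewrite /madd /eunit eqxx vr_eq //= addn0 addn1 scalerA mulnC fact_ratio.
by rewrite (linZ (brr t0)) mulnC.
Qed.

Lemma di_flow i s : (2 <= i < 8)%N -> d i (flow s) = 0.
Proof.
move=> /andP[i2 i8]; apply/funext => m; rewrite /spartial /sderiv /flow xt_only_madd //.
by rewrite ltnNge i2 /= scaler0.
Qed.

Lemma d1_time_flow : d 1 time_flow = fun m => br t0 (time_flow m).
Proof.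
apply/funext => m; rewrite /spartial /sderiv /time_flow t_only_madd //=; case: ifP => _; last first.
  by rewrite scaler0 (lin0 (brr t0)).
rewrite /madd /eunit eqxx addn1 scalerA -[(_.+1)`!]muln1 fact_ratio muln1.
by rewrite (linZ (brr t0)).
Qed.

Lemma di_time_flow i : (i < 8)%N -> i != 1%N -> d i time_flow = 0.
Proof.
move=> i8 i1; apply/funext => m; rewrite /spartial /sderiv /time_flow t_only_madd //.
by rewrite (negbTE i1) /= scaler0.
Qed.

Let only0 : xt_only (fun=> 0%N) /\ t_only (fun=> 0%N).
Proof. by split; apply/forallP => j; rewrite implybT. Qed.
Lemma flow0 s : flow s (fun=> 0%N) = s.
Proof. by rewrite /flow only0.1 /= invr1 scale1r. Qed.
Lemma time_flow0 : time_flow (fun=> 0%N) = r0.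
Proof. by rewrite /time_flow only0.2 /= invr1 scale1r. Qed.

Let coef_br (f g : mono -> M) : (fun m => br t0 (sb f g m)) =
  sb (fun m => br t0 (f m)) g + sb f (fun m => br t0 (g m)).
Proof.
apply/funext => m; rewrite fctE /sbr /subsum (lin_sum (brr t0)) -big_split /=.
by apply: eq_bigr => n _; rewrite br_der.
Qed.

Let dcases (i : 'I_8) : [\/ i = vr 0, i = vr 1 | exists2 k, i = vr k & (2 <= k < 8)%N].
Proof.
have vi : i = vr i by apply: val_inj; rewrite /= inordK.
case: (nat_of_ord i) (ltn_ord i) vi => [|[|k]] k8 vi.
- by constructor 1.
- by constructor 2.
- by constructor 3; exists k.+2.
Qed.

Let sb0 f g : sb f g (fun=> 0%N) = br (f (fun=> 0%N)) (g (fun=> 0%N)).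
Proof. exact: (conv_mono0 br f g). Qed.

(** Exponentials of inner derivations are automorphisms. *)
Lemma flow_br s s' : sb (flow s) (flow s') = flow (br s s').
Proof.
apply/funext => m; elim/mono_ind: m s s' => [|i m IH] s s'.
  by rewrite sb0 !flow0.
rewrite !sderiv_scaled; congr (_ *: _); case: (dcases i) => [->|->|[k -> k2]].
- by rewrite -!/(d 0 _) (sa_dbr SA) !d0_flow fctE !IH (br_der g0 s s') (linD flowL).
- by rewrite -!/(d 1 _) (sa_dbr SA) !d1_flow -coef_br /= IH.
- by rewrite -!/(d k _) (sa_dbr SA) !di_flow // (br0l SA) (br0r SA) addr0.
Qed.

(** exp(t ad t0) fixes t0, so the splitting of t0 into a multiple of g0 and - r0 is transported
    along t. In the induction the defect for [s] has x-derivative the defect for [g0, s] and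
    t-derivative its bracket with t0. *)
Lemma d1_flow_eq s : d 1 (flow s) = speed *: flow (br g0 s) - sb time_flow (flow s).
Proof.
apply/eqP; rewrite -subr_eq0; apply/eqP; rewrite d1_flow.
apply/funext => m; elim/mono_ind: m s => [|i m IH] s.
  rewrite !fctE sb0 !flow0 time_flow0 /t0.
  by rewrite (linD (brl s)) (linZ (brl s)) (linN (brl s)) subrr.
rewrite sderiv_scaled [RHS]series0E.
suff -> : sderiv i ((fun m => br t0 (flow s m)) - (speed *: flow (br g0 s) - sb time_flow (flow
  s))) m = 0.
  by rewrite scaler0.
have coefD k f : d k (fun m => br t0 (f m)) = fun m => br t0 (d k f m).
  by apply/funext => m'; rewrite /spartial /sderiv (linZ (brr t0)).
case: (dcases i) => [->|->|[k -> k2]].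
- rewrite -/(d 0 _) !(dE SA) coefD !(sa_dbr SA) !d0_flow di_time_flow // (br0l SA) add0r.
  exact: IH.
- rewrite -/(d 1 _) !(dE SA) coefD !(sa_dbr SA) !d1_flow d1_time_flow -coef_br.
  have := congr1 (br t0) (IH s).
  rewrite !fctE series0E (lin0 (brr t0)) !(linD (brr t0)) !(linN (brr t0)) !(linD (brr t0))
    !(linN (brr t0)) (linZ (brr t0)).
  exact.
- rewrite -/(d k _) !(dE SA) coefD !(sa_dbr SA) !di_flow // (di_time_flow (i := k)) //.
  + rewrite (br0l SA) (br0r SA) !fctE !series0E (lin0 (brr t0)); mod0 K M.
  + by case/andP: k2.
  + by case: k k2 => [|[|k]].
Qed.

Let P k := flow (iter k (br g0) e0).
Let d0P k : d 0 (P k) = P k.+1. Proof. exact: d0_flow. Qed.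
Let dkP i k : (2 <= i < 8)%N -> d i (P k) = 0. Proof. exact: di_flow. Qed.
Let P0P2 : sb (P 0) (P 2) = - a *: P 1.
Proof. by rewrite flow_br [iter 2 _ _]/= E02 (linZ flowL). Qed.
Let P0H : sb (P 0) (sb (P 0) (P 1)) = 0.
Proof. by rewrite !flow_br E0H (lin0 flowL). Qed.
Let P3E : P 3 = - k0 *: P 1.
Proof. by rewrite /P [iter 3 _ _]/= E3 (linZ flowL). Qed.
Let P4E : P 4 = - k0 *: P 2.
Proof. by rewrite -d0P P3E (dE SA) d0P. Qed.
Let P5E : P 5 = (k0 * k0) *: P 1.
Proof. by rewrite -d0P P4E (dE SA) d0P P3E; mod0 K (mono -> M). Qed.
Let A := X 2 (P 0).
Let B := flux sb X al be ak P + time_flow.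

Let A_zero m : m (vr 2) = 0%N -> A m = 0.
Proof. by move=> m2; rewrite /A /sshift /smulvar m2. Qed.

Let A_deriv i : (3 <= i < 8)%N -> d i A = 0.
Proof.
move=> /andP[i3 i8]; rewrite /A (sa_dX SA) dkP ?i8 ?(ltnW i3) // (X0 SA) add0r.
by case: i i3 i8 => [|[|[|[|[|[|[|[|i]]]]]]]].
Qed.

Let d7B : d 7 B = 0.
Proof. by rewrite /B (dE SA) (d7_flux SA) // di_time_flow // addr0. Qed.

Let eq0_of_deriv i (f : mono -> M) m : d i f = 0 -> (0 < m (vr i))%N -> f m = 0.
Proof. by move=> df mi; rewrite (mono_split mi) sderiv_scaled -/(spartial i f) df series0E
  scaler0. Qed.

Let r0_gauge m : t_only m -> gauge_value al be ak br P m = - time_flow m.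
Proof.
move=> tm; have xm : xt_only m.
  apply/forallP => j; apply/implyP => j1; move/forallP: tm => /(_ j).
  by case: eqP j1 => // ->; rewrite /vr inordK.
have m0 : m (vr 0) = 0%N by move/forallP: tm => /(_ (vr 0)); rewrite vr_eq //= => /eqP.
have -> : - time_flow m = flow (- r0) m.
  rewrite /time_flow /flow tm xm m0 /= fact0 mul1n.
  by rewrite (linN (fun k x y => iter_lin _ _ k x y)) scalerN.
have -> : gauge_value al be ak br P = flow (- r0) => //.
rewrite /gauge_value central_jetE flow_br /r0 opprK.
rewrite !(linD flowL) !(linN flowL) !(linZ flowL) !(linD flowL) !(linN flowL) !(linZ flowL)
  ?(linD flowL) ?(linN flowL) ?(linZ flowL).
by mod0 K (mono -> M).
Qed.

(** Two elements with the three relations above yield a solution of all relations of F^0, to which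
    the universal property applies. *)
Lemma flow_model : exists hA hB, F0_relations al be ak br hA hB /\
  [/\ hA 0 0 1 = e0, hA 1 0 1 = e1 & 2%:R *: hA 2 0 1 = e2].
Proof.
pose hA i j k := A (monomial [:: i; j; k]).
pose hB l1 l2 j0 j1 j2 j3 j4 := B (monomial [:: l1; l2; j0; j1; j2; j3; j4]).
have mE (s : seq nat) i : (i < 8)%N -> monomial s (vr i) = nth 0%N s i.
  by move=> i8; rewrite /monomial /vr inordK.
have mono_eqP (m m' : mono) : (forall k, (k < 8)%N -> m (vr k) = m' (vr k)) -> m = m'.
  move=> e; apply/funext => j; have -> : j = vr j by apply: val_inj; rewrite /= inordK.
  exact: e.
have EA : Aser hA = A.
  apply/funext => m; rewrite /Aser; case: ifP => [/forallP all0|/negbT].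
    rewrite /hA; congr A; apply: mono_eqP => k k8; rewrite mE //.
    case: k k8 => [|[|[|k]]] //= k8; rewrite nth_nil.
    by have := all0 (vr k.+3); rewrite {1}/vr inordK // => /eqP.
  rewrite negb_forall => /existsP[j]; have vj : j = vr j by apply: val_inj; rewrite /= inordK.
  rewrite negb_imply => /andP[j2 mj]; rewrite (@eq0_of_deriv j) ?A_deriv ?j2 ?ltn_ord //.
  by rewrite -vj lt0n.
have EB : Bser hB = B.
  apply/funext => m; rewrite /Bser; case: ifP => [/eqP m7|/negbT m7].
    rewrite /hB; congr B; apply: mono_eqP => k k8; rewrite mE //.
    by case: k k8 => [|[|[|[|[|[|[|[|k]]]]]]]].
  by rewrite (@eq0_of_deriv 7) ?d7B // lt0n.
exists hA, hB; split; first split.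
- move=> m; rewrite zc_coefE EA EB zc_op_cov.
  suff -> : cov sb d X ak A B - (d 1 A + jetF X al be ak (d 2 A)) = 0 by [].
  have -> : d 2 A = P 0.
    by rewrite /A (sa_dX SA) dkP // (X0 SA) add0r.
  (* The quadratic coefficient of the remainder vanishes; the linear one is the bracket of
     [time_flow] with P_0 and cancels against [covR]. *)
  have := cov_flux SA be ak d0P dkP P0P2 P0H.
  have P1P3 : sb (P 1) (P 3) = 0 by rewrite P3E (brZr SA) (sa_br_alt SA) scaler0.
  have P0P4 : sb (P 0) (P 4) = k0 * a *: P 1.
    by rewrite P4E (brZr SA) P0P2; mod0 K (mono -> M).
  rewrite P1P3 P0P4 P5E P3E [d 1 (P 0)]d1_flow_eq -/(P 1) -/(P 0) => e.
  have covR : cov sb d X ak A time_flow = - X 2 (sb time_flow (P 0)).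
    rewrite covE !di_time_flow // !(jet0 SA) /A (sa_brXl SA) (br_anti SA time_flow) (XE SA).
    by rewrite !addr0 add0r.
  rewrite /B (covD SA) covR.
  rewrite !(XE SA) /speed in e.
  modlin0 K (mono -> M) (1 ** e).
- move=> l1 l2; rewrite /hA A_zero // /monomial /vr inordK //.
- move=> l2; rewrite /hB; set m := monomial _.
  have tm : t_only m.
    apply/forallP => j; apply/implyP; rewrite -val_eqE /= inordK // /m /monomial.
    by case: (nat_of_ord j) => [|[|[|[|[|[|[|k]]]]]]] //=; rewrite nth_nil.
  have pm : pure_time m.
    by move=> i i1; move/forallP: tm => /(_ i); rewrite i1 /= => /eqP.
  by rewrite /B fctE (flux_time be brP P3E pm) r0_gauge // addNr.
have AE i : A (monomial [:: i; 0%N; 1%N]) = (i`!)%:R^-1 *: iter i (br g0) e0.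
  have -> : monomial [:: i; 0%N; 1%N] = madd (monomial [:: i]) (eunit (vr 2)).
    apply: mono_eqP => k k8; rewrite /madd /eunit vr_eq // !mE //.
    by case: k k8 => [|[|[|k]]] //= _; rewrite ?addn0 ?nth_nil.
  rewrite sderiv_scaled -/(d 2 A) /A (sa_dX SA) dkP // (X0 SA) add0r /kron /= mE //= invr1 scale1r.
  rewrite /P /flow; case: ifP => [_|/negbT].
    by rewrite !mE //= fact0 muln1.
  rewrite negb_forall => /existsP[j]; rewrite negb_imply => /andP[j1].
  by rewrite /monomial; case: (nat_of_ord j) j1 => [|k] //=; rewrite nth_nil.
rewrite /hA !AE /= fact0 (_ : 1`! = 1%N) // (_ : 2`! = 2%N) // invr1 !scale1r; split=> //.
by rewrite scalerA mulfV ?scale1r ?pnatr_eq0.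
Qed.
End FlowModel.

(** * The two cases of the theorem *)

Section CommutatorMatrices.
Variable K : numFieldType.

Definition mx22 (x y z t : K) : 'M[K]_2 :=
  \matrix_(i < 2, j < 2) (if i == 0 then if j == 0 then x else y else if j == 0 then z else t).

Lemma mx22P (x y z t : K) (M : 'M[K]_2) :
  M 0 0 = x -> M 0 1 = y -> M 1 0 = z -> M 1 1 = t -> M = mx22 x y z t.
Proof.
have ord2 (i : 'I_2) : i = 0 \/ i = 1.
  by case: i => [[|[|i]] ilt] //; [left | right]; apply: val_inj.
move=> <- <- <- <-; apply/matrixP => i j; rewrite mxE.
by case: (ord2 i) => ->; case: (ord2 j) => ->.
Qed.

Lemma mx22_eta (M : 'M[K]_2) : M = mx22 (M 0 0) (M 0 1) (M 1 0) (M 1 1).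
Proof. exact: mx22P. Qed.

Lemma mx22D x y z t x' y' z' t' :
  mx22 x y z t + mx22 x' y' z' t' = mx22 (x + x') (y + y') (z + z') (t + t').
Proof. by apply: mx22P; rewrite !mxE. Qed.
Lemma mx22N x y z t : - mx22 x y z t = mx22 (- x) (- y) (- z) (- t).
Proof. by apply: mx22P; rewrite !mxE. Qed.
Lemma mx22Z k x y z t : k *: mx22 x y z t = mx22 (k * x) (k * y) (k * z) (k * t).
Proof. by apply: mx22P; rewrite !mxE. Qed.
Lemma mx22M x y z t x' y' z' t' : mx22 x y z t *m mx22 x' y' z' t' =
  mx22 (x * x' + y * z') (x * y' + y * t') (z * x' + t * z') (z * y' + t * t').
Proof. by apply: mx22P; rewrite !mxE !big_ord_recr big_ord0 /= !mxE /= add0r. Qed.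
Definition mx22E := (mx22M, mx22Z, mx22N, mx22D).

Lemma mx22_inj x y z t x' y' z' t' :
  mx22 x y z t = mx22 x' y' z' t' -> [/\ x = x', y = y', z = z' & t = t'].
Proof.
move=> e; split.
- by have := congr1 (fun M : 'M_2 => M 0 0) e; rewrite !mxE.
- by have := congr1 (fun M : 'M_2 => M 0 1) e; rewrite !mxE.
- by have := congr1 (fun M : 'M_2 => M 1 0) e; rewrite !mxE.
- by have := congr1 (fun M : 'M_2 => M 1 1) e; rewrite !mxE.
Qed.

Definition commutator (M N : 'M[K]_2) : 'M[K]_2 := M *m N - N *m M.

Lemma commutator_lie : lie_axioms commutator.
Proof.
rewrite /commutator; split.
- move=> c x y z; rewrite mulmxDl mulmxDr -scalemxAl -scalemxAr; mod0 K 'M[K]_2.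
- move=> c x y z; rewrite mulmxDl mulmxDr -scalemxAl -scalemxAr; mod0 K 'M[K]_2.
- by move=> x; rewrite subrr.
- move=> x y z; rewrite !mulmxBl !mulmxBr !mulmxA; mod0 K 'M[K]_2.
Qed.
End CommutatorMatrices.

(** * Identification with gl_2, and the nilpotent case *)

Section MainCases.
Variables (K : numFieldType) (al be xa ta : K) (ak : nat -> K).
Variables (L : lmodType K) (br : L -> L -> L).
Variables (gA : nat -> nat -> nat -> L)
          (gB : nat -> nat -> nat -> nat -> nat -> nat -> nat -> L).
Hypothesis F0 : is_F0 al be xa ta ak br gA gB.
Hypotheses (ab : al + be != 0) (ab6 : 6%:R * al + be != 0) (ab16 : 16%:R * al + be != 0).

Lemma F0_iso_sl2_plus_abelian : al != 0 -> iso_sl2_plus_abelian br 3.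
Proof.
move=> al0; have [brP rel gen univ] := F0.
have [span r02 r12 rq] := F0_structure brP rel gen ab ab6 ab16.
(* Here g0^2 = - 2 al a_0, so (ad g0)^3 = - 8 al a_0 ad g0, which is [E3]. *)
pose g0 := mx22 0 (ak 0) (- (2%:R * al)) 0 : 'M[K]_2.
(* Identity plus a nilpotent. The identity makes [e0, e1] + 4 al e0 = 4 al, so q goes to a nonzero
   scalar and the image is all of gl_2. *)
pose e0 := mx22 1 1 0 1 : 'M[K]_2.
pose cm := @commutator K.
have E1 : cm g0 e0 = mx22 (2%:R * al) 0 0 (- (2%:R * al)).
  by rewrite /cm /commutator !mx22E; congr mx22; ring.
have E2 : cm g0 (cm g0 e0) = mx22 0 (- (4%:R * al * ak 0)) (- (8%:R * al * al)) 0.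
  by rewrite E1 /cm /commutator !mx22E; congr mx22; ring.
have E01 : cm e0 (cm g0 e0) = mx22 0 (- (4%:R * al)) 0 0.
  by rewrite E1 /cm /commutator !mx22E; congr mx22; ring.
have [|||hA [hB [hrel [hA0 hA1 hA2]]]] :=
  flow_model (commutator_lie K) be (ak := ak) (al := al) (g0 := g0) (e0 := e0).
- by rewrite -/cm E2 E1 /cm /commutator !mx22E; congr mx22; ring.
- by rewrite -/cm E01 /cm /commutator !mx22E -[RHS](scale0r e0) mx22E; congr mx22; ring.
- by rewrite -/cm E2 E1 /cm /commutator !mx22E; congr mx22; ring.
have [phi [[phiL phi_br] [phiA _]]] := univ _ _ hA hB (commutator_lie K) hrel.
have phi_p2 : phi (2%:R *: gA 2 0 1) = cm g0 (cm g0 e0).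
  by rewrite (linZ phiL) phiA hA2.
have phiE c0 c1 c2 c3 : phi (c0 *: gA 0 0 1 + c1 *: gA 1 0 1 + c2 *: (2%:R *: gA 2 0 1)
    + c3 *: (br (gA 0 0 1) (gA 1 0 1) + (4%:R * al) *: gA 0 0 1)) =
  mx22 (c0 + 2%:R * al * c1 + 4%:R * al * c3) (c0 - 4%:R * al * ak 0 * c2)
       (- (8%:R * al * al) * c2) (c0 - 2%:R * al * c1 + 4%:R * al * c3).
  rewrite !(linD phiL) (linZ phiL c0) (linZ phiL c1) (linZ phiL c2) (linZ phiL c3).
  rewrite phi_p2 (linD phiL) phi_br (linZ phiL) !phiA hA0 hA1 -/cm E01 E2 E1 !mx22E.
  by congr mx22; ring.
have phi_inj x y : phi x = phi y -> x = y.
  have [x0 [x1 [x2 [x3 ->]]]] := span x; have [y0 [y1 [y2 [y3 ->]]]] := span y.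
  rewrite !phiE => /mx22_inj[e00 e01 e10 e11].
  have x2y : x2 = y2.
    by apply: (@mulfI _ (- (8%:R * al * al))); rewrite // oppr_eq0 !mulf_neq0 ?pnatr_eq0.
  have x0y : x0 = y0 by move: e01; rewrite x2y => /addIr.
  have x1y : x1 = y1.
    apply: (@mulfI _ (4%:R * al)); rewrite ?mulf_neq0 ?pnatr_eq0 //.
    have -> : 4%:R * al * x1 = (x0 + 2%:R * al * x1 + 4%:R * al * x3) - (x0 - 2%:R * al * x1 +
      4%:R * al * x3) by ring.
    by rewrite e00 e11; ring.
  have x3y : x3 = y3.
    apply: (@mulfI _ (4%:R * al)); rewrite ?mulf_neq0 ?pnatr_eq0 //.
    by apply: (@addrI _ (x0 + 2%:R * al * x1)); rewrite e00 x0y x1y.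
  by rewrite x0y x1y x2y x3y.
have phi_surj M : exists x, phi x = M.
  (* The witness solves [phiE] for the four coordinates. *)
  pose c2 := - M 1 0 / (8%:R * al * al).
  pose c0 := M 0 1 + 4%:R * al * ak 0 * c2.
  exists (c0 *: gA 0 0 1 + ((M 0 0 - M 1 1) / (4%:R * al)) *: gA 1 0 1 + c2 *: (2%:R *: gA 2 0 1)
    + (((M 0 0 + M 1 1) / 2%:R - c0) / (4%:R * al))
       *: (br (gA 0 0 1) (gA 1 0 1) + (4%:R * al) *: gA 0 0 1)).
  rewrite phiE [RHS]mx22_eta /c0 /c2; congr mx22; by field.
pose tr2 x : K := \tr (phi x) / 2%:R.
(* The projections are the traceless part and the trace: scalars are central and commutators have
   trace zero. *)
exists 1%N; split=> //.
exists (fun x => phi x - (tr2 x)%:M), (fun x => \row_(_ < 1) \tr (phi x)); split.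
- move=> c x y; rewrite /tr2 phiL mxtraceD mxtraceZ; split; last by apply/rowP => i; rewrite !mxE.
  rewrite mulrDl -mulrA [X in _ - X]raddfD /= -scale_scalar_mx; mod0 K 'M[K]_2.
- move=> x y e /rowP /(_ 0); rewrite !mxE => t; apply: phi_inj.
  by move: e; rewrite /tr2 t => /addIr.
- move=> x; rewrite raddfB /= mxtrace_scalar /tr2 -mulr_natr; by field.
- move=> X w trX; have [x ex] := phi_surj (X + (w 0 0 / 2%:R)%:M).
  have trw : \tr ((w 0 0 / 2%:R)%:M : 'M[K]_2) = w 0 0 by rewrite mxtrace_scalar -mulr_natr;
    by field.
  exists x; rewrite /tr2 ex mxtraceD trX add0r trw.
  split; first by rewrite addrK.
  by apply/rowP => i; rewrite mxE (ord1 i).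
- move=> x y; rewrite /tr2 phi_br /commutator.
  have t0 : \tr (phi x *m phi y - phi y *m phi x) = 0 by rewrite raddfB /= mxtrace_mulC subrr.
  rewrite t0 mul0r -/(tr2 x) -/(tr2 y); split; last by apply/rowP => i; rewrite !mxE.
  rewrite !mulmxBl !mulmxBr !mul_scalar_mx !mul_mx_scalar (_ : (0 : K)%:M = 0) ?raddf0 //.
  rewrite !scale_scalar_mx (mulrC (tr2 y)).
  by mod0 K 'M[K]_2.
Qed.

(** The only surviving bracket of the spanning elements is [p0, p1] = q, so the algebra is a
    quotient of the Heisenberg algebra plus a central line. *)
Lemma F0_nilpotent : al = 0 -> lie_nilpotent br /\ dim_le L 6.
Proof.
move=> al0; have [brP rel gen _] := F0.
have [span r02 r12 rq] := F0_structure brP rel gen ab ab6 ab16.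
move: span r02 r12 rq; rewrite al0 !mulr0 !mul0r !scale0r oppr0 !scale0r !addr0.
set p0 := gA 0 0 1; set p1 := gA 1 0 1; set p2 := _ *: _; set q := br p0 p1 => span r02 r12 rq.
clearbody p0 p1 p2; split; last first.
  exists [:: p0; p1; p2; q]; split=> // x; have [c0 [c1 [c2 [c3 ->]]]] := span x.
  exists (fun i => nth 0 [:: c0; c1; c2; c3] i).
  by rewrite !big_ord_recr big_ord0 /= add0r.
have [bL bR b0 _] := brP.
have brl z : forall (k : K) x y, br (k *: x + y) z = k *: br x z + br y z by move=> *; apply: bL.
have brr z : forall (k : K) x y, br z (k *: x + y) = k *: br z x + br z y by move=> *; apply: bR.
have anti x y : br y x = - br x y.
  apply/eqP; rewrite -addr_eq0; apply/eqP; have := b0 (x + y).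
  by rewrite (linD (brl _)) !(linD (brr _)) !b0 add0r addr0 addrC.
have brq x : br x q = 0 by rewrite anti rq oppr0.
have br_q x y : exists k : K, br x y = k *: q.
  have [x0 [x1 [x2 [x3 ->]]]] := span x; have [y0 [y1 [y2 [y3 ->]]]] := span y.
  exists (x0 * y1 - x1 * y0).
  rewrite !(linD (brl _)) !(linZ (brl _)) !(linD (brr _)) !(linZ (brr _)) !rq !brq !b0.
  rewrite (anti p0 p1) (anti p0 p2) (anti p1 p2) r02 r12 -/q.
  mod0 K L.
(* Index 0 of [lcs] is the whole algebra, index 1 lies on the line of q, and index 2 vanishes. *)
exists 2%N => x; have lcsP n y : lcs br n y -> ((0 < n)%N -> exists k : K,
  y = k *: q) /\ ((1 < n)%N -> y = 0).
  elim=> {n y} [y|k|k x1 x2 _ [h1 h2] _ [h1' h2']|k c x1 _ [h1 h2]|k x1 x2 _ [h1 h2]].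
  - by [].
  - by split=> // _; exists 0; rewrite scale0r.
  - split=> [_|k1]; last by rewrite h2 // h2' // addr0.
    have [k1 ->] := h1 isT; have [k2 ->] := h1' isT.
    by exists (k1 + k2); rewrite scalerDl.
  - split=> [_|k1]; last by rewrite h2 // scaler0.
    by have [k1 ->] := h1 isT; exists (c * k1); rewrite scalerA.
  - split=> [_|k1]; first exact: br_q.
    by have [k2 ->] := h1 k1; rewrite (linZ (brr _)) brq scaler0.
by move=> /lcsP[_ ->].
Qed.
End MainCases.

(** The argument is uniform in the field; [numFieldType] covers both the reals and the complex
    numbers. *)
Lemma theorem4p9_numField (K : numFieldType) : theorem4p9_over K.
Proof.
move=> al be xa ta ak L br gA gB F0; split=> [ab ab6 ab16 al0|al0 be0].
  exact: (F0_iso_sl2_plus_abelian F0 ab ab6 ab16 al0).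
(* For al = 0 the three nonvanishing conditions all read be <> 0. *)
by apply: (F0_nilpotent F0) => //; rewrite al0 ?mulr0 add0r.
Qed.

(* K = R (any model of the reals, R : realType) or K = C = R[i]. *)
Theorem theorem4p9 (R : realType) :
  theorem4p9_over R /\ theorem4p9_over R[i].
Proof. by split; exact: theorem4p9_numField. Qed.
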